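(* Fix $n\geq 2$. Then: (i) The linear action of $G_n$ on $\mathbb{T}^n$ is ergodic and essentially free (with respect to the normalized Lebesgue measure). (ii) If $n$ is even and $h\in\operatorname{SL}_2(\mathbb{Z})$ is hyperbolic, then the cyclic subgroup $\langle h\rangle$ generated by $h$ acts ergodically on $\mathbb{T}^n$ (via the linear action).
   Context: For $n\geq 1$, let $P_{n-1}(\mathbb{R})$ be the real vector space of homogeneous polynomials of degree $n-1$ in two variables $X,Y$, identified with $\mathbb{R}^n$ via the basis $X^{n-1},X^{n-2}Y,\ldots,Y^{n-1}$. The representation $\rho_{n-1}$ of $\operatorname{SL}_2(\mathbb{R})$ on $P_{n-1}(\mathbb{R})$ is $\big(\rho_{n-1}\begin{pmatrix}a&b\\c&d\end{pmatrix}P\big)(X,Y)=P(aX+cY,bX+dY)$. The lattice $P_{n-1}(\mathbb{Z})$ of integer-coefficient polynomials is $\rho_{n-1}(\operatorname{SL}_2(\mathbb{Z}))$-invariant, giving an action of $\operatorname{SL}_2(\mathbb{Z})$ on $\mathbb{T}^n=P_{n-1}(\mathbb{R})/P_{n-1}(\mathbb{Z})$; for $n$ odd it factors through $\operatorname{PSL}_2(\mathbb{Z})$. Set $G_n=\operatorname{SL}_2(\mathbb{Z})$ for $n$ even and $G_n=\operatorname{PSL}_2(\mathbb{Z})$ for $n$ odd; the resulting action $G_n\curvearrowright\mathbb{T}^n$ is called the linear action. It preserves normalized Lebesgue measure. A matrix $h\in\operatorname{SL}_2(\mathbb{Z})$ is hyperbolic if $|\operatorname{tr}(h)|>2$. 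*)

(* Defs.v *)
From HB Require Import structures.
From mathcomp Require Import all_boot all_order all_algebra.
From mathcomp Require Import all_classical all_reals all_analysis.
Set Implicit Arguments. Unset Strict Implicit. Unset Printing Implicit Defensive.
Import Order.TTheory GRing.Theory Num.Theory.
Local Open Scope classical_set_scope.
Local Open Scope ring_scope.

(* Points of R^n are functions 'I_n -> R; the torus T^n = R^n / Z^n is
   modelled by Z^n-periodic subsets of R^n, with the normalized Lebesgue
   measure of a periodic set given by the Lebesgue measure of its trace on
   the unit cube [0,1)^n (which has volume 1). *)
Definition vecR (R : realType) (n : nat) := 'I_n -> R.

Definition i0 : 'I_2 := ord0.
Definition i1 : 'I_2 := ord_max.

Definition SL2Z (g : 'M[int]_2) : Prop := \det g = 1.

(* Coordinate j of rho_{n-1}(g) applied to the basis vector X^{n-1-i} Y^i.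
   A homogeneous polynomial Q of degree n-1 is determined by its
   dehomogenization Q(1,t), whose coefficient of t^j is the coefficient of
   X^{n-1-j} Y^j.  For P = X^{n-1-i} Y^i, (rho g P)(1,t) = P(a + c t, b + d t)
   = (a + c t)^(n-1-i) (b + d t)^i. *)
Definition rho_coef (n : nat) (g : 'M[int]_2) (i j : 'I_n) : int :=
  ((((g i0 i0)%:P + (g i1 i0) *: 'X) ^+ (n.-1 - i)
    * ((g i0 i1)%:P + (g i1 i1) *: 'X) ^+ i)`_j)%R.

Definition rho (R : realType) (n : nat) (g : 'M[int]_2) (x : vecR R n)
  : vecR R n :=
  fun j => \sum_(i < n) x i * (rho_coef g i j)%:~R.

Definition int_vec (R : realType) (n : nat) (x : vecR R n) : Prop :=
  forall i, x i \is a Num.int.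

(* A subset of T^n, viewed as its Z^n-periodic preimage in R^n. *)
Definition torus_set (R : realType) (n : nat) (A : set (vecR R n)) : Prop :=
  forall x y : vecR R n, int_vec (fun i => x i - y i) -> A x -> A y.

Definition unit_cube (R : realType) (n : nat) : set (vecR R n) :=
  [set x | forall i, 0 <= x i < 1].

Definition box (R : realType) (n : nat) (lo hi : vecR R n) : set (vecR R n) :=
  [set x | forall i, lo i <= x i <= hi i].

Definition box_vol (R : realType) (n : nat) (lo hi : vecR R n) : R :=
  \prod_(i < n) Num.max (hi i - lo i) 0.

Definition leb_outer (R : realType) (n : nat) (A : set (vecR R n)) : \bar R :=
  ereal_inf [set s : \bar R | exists lo hi : nat -> vecR R n,
     A `<=` \bigcup_k box (lo k) (hi k) /\
     s = (\sum_(0 <= k <oo) (box_vol (lo k) (hi k))%:E)%E].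

Definition leb_measurable (R : realType) (n : nat) (A : set (vecR R n)) : Prop :=
  forall E : set (vecR R n),
    leb_outer E = (leb_outer (E `&` A) + leb_outer (E `&` ~` A))%E.

Definition torus_null (R : realType) (n : nat) (A : set (vecR R n)) : Prop :=
  leb_outer (A `&` @unit_cube R n) = 0%E.

Definition ergodic_on (R : realType) (n : nat) (S : set 'M[int]_2) : Prop :=
  forall A : set (vecR R n),
    torus_set A -> leb_measurable A ->
    (forall g, S g -> forall x, A (rho g x) <-> A x) ->
    torus_null A \/ torus_null (~` A).

(* g is not the identity element of G_n (G_n = SL_2(Z) for n even,
   PSL_2(Z) = SL_2(Z)/{+-1} for n odd) *)
Definition nontrivial_in_Gn (n : nat) (g : 'M[int]_2) : Prop :=
  if odd n then g <> 1%R /\ g <> (-1)%R else g <> 1%R.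

(* Essential freeness: the set of points of T^n with non-trivial stabilizer
   in G_n is null.  g.[x] = [x] in T^n iff rho g x - x is in Z^n. *)
Definition essentially_free (R : realType) (n : nat) : Prop :=
  torus_null [set x : vecR R n | exists g, SL2Z g /\ nontrivial_in_Gn n g /\
                 int_vec (fun i => rho g x i - x i)].

Definition hyperbolic (h : 'M[int]_2) : Prop := 2 < `|\tr h|.

Definition cyclic_subgroup (h : 'M[int]_2) : set 'M[int]_2 :=
  [set g | exists k : int, g = h ^ k].

(* Main.v *)
Require Import Defs.
From HB Require Import structures.
From mathcomp Require Import all_boot all_order all_algebra.
From mathcomp Require Import all_classical all_reals all_analysis.
From mathcomp Require Import ring lra zify.
Import Order.TTheory GRing.Theory Num.Theory.
Import numFieldNormedType.Exports.
Local Open Scope classical_set_scope.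
Local Open Scope ring_scope.
Set Implicit Arguments. Unset Strict Implicit. Unset Printing Implicit Defensive.

(** Ergodicity: let [A] be invariant with trace of measure [r] on the unit cube
    and cover this trace by boxes of total volume at most [r + e], a finite
    union [U] of them together with a tail of volume at most [e].  For every
    [g] the set [A] lies, up to measure [2 e], in the intersection of [U] and
    [g^-1 U].  If [f] is a nonnegative trigonometric polynomial majorizing [U]
    with mean at most [r + 2 e], that intersection has measure at most the mean
    of [f * (f o g)], which is (mean f)^2 as soon as the transpose of [g] moves
    no nonzero frequency of [f] to the opposite of one of its frequencies.
    Such a [g] exists when the acting set moves every nonzero frequency out of
    every finite set.  Hence [r <= (r + 2 e)^2 + 2 e] for all [e > 0], so
    [r = 0] or [r = 1].

    No integration is needed: the grid average of a trigonometric polynomial on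
    a grid finer than its frequencies is exactly its mean.

    Freeness: the points fixed modulo Z^n by [g] satisfy [l.x \in Z] for some
    integer vector [l <> 0]; such a set is null, by the same majorants, and
    there are countably many [g]. *)

(** * Symmetric powers of the standard representation *)

Section SymPower.
Variables (K : comNzRingType).
Implicit Types (g h : 'M[K]_2) (N : nat).

Definition rho_poly N g (i : nat) : {poly K} :=
  ((g i0 i0)%:P + (g i1 i0) *: 'X) ^+ (N - i)
  * ((g i0 i1)%:P + (g i1 i1) *: 'X) ^+ i.

Definition rho_mx N g : 'M[K]_N.+1 :=
  \matrix_(i, j) (rho_poly N g i)`_j.

(** The binary form of degree [N] with dehomogenization [p], evaluated at [(U, V)]; composition of
    substitutions is expressed through it. *)
Definition homog N (p U V : {poly K}) : {poly K} :=
  \sum_(j < N.+1) p`_j *: (U ^+ (N - j) * V ^+ j).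

Lemma homog_mul_lin N (p U V : {poly K}) (a c : K) : (size p <= N.+1)%N ->
  homog N.+1 (p * (a%:P + c *: 'X)) U V = homog N p U V * (a *: U + c *: V).
Proof.
move=> sp; rewrite /homog.
have cE j : (p * (a%:P + c *: 'X))`_j = a * p`_j + c * (p * 'X)`_j.
  by rewrite mulrDr -scalerAr coefD coefZ coefMC mulrC.
under eq_bigr => j _ do rewrite cE scalerDl.
rewrite big_split /= big_ord_recr /= nth_default // mulr0 scale0r addr0.
rewrite [X in _ + X]big_ord_recl /= coefMX /= mulr0 scale0r add0r.
rewrite mulrDr; congr (_ + _); rewrite mulr_suml; apply: eq_bigr => j _.
  rewrite subSn; last by rewrite -ltnS ltn_ord.
  rewrite exprS -!scalerAl -!scalerAr scalerA [a * _]mulrC; congr (_ *: _).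
  by rewrite -mulrA mulrC.
rewrite coefMX /= subSS exprSr -!scalerAl -!scalerAr scalerA [c * _]mulrC.
by rewrite mulrA.
Qed.

Lemma size_lin (a c : K) : (size (a%:P + c *: 'X)%R <= 2)%N.
Proof.
rewrite (leq_trans (size_polyD _ _)) // geq_max.
rewrite (leq_trans (size_polyC_leq1 _)) //=.
by rewrite (leq_trans (size_scale_leq _ _)) // size_polyX.
Qed.

Lemma size_lin_exp (a c : K) m : (size ((a%:P + c *: 'X) ^+ m)%R <= m.+1)%N.
Proof.
elim: m => [|m IH]; first by rewrite expr0 size_poly1.
rewrite exprS (leq_trans (size_polyMleq _ _)) //.
have := size_lin a c; move: IH; lia.
Qed.

Lemma size_lin2_exp (a b c d : K) m k :
  (size ((a%:P + c *: 'X) ^+ m * (b%:P + d *: 'X) ^+ k)%R <= (m + k).+1)%N.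
Proof.
rewrite (leq_trans (size_polyMleq _ _)) //.
have := size_lin_exp a c m; have := size_lin_exp b d k; lia.
Qed.

Lemma homog_lin_exp (U V : {poly K}) (a b c d : K) m k :
  homog (m + k) ((a%:P + c *: 'X) ^+ m * (b%:P + d *: 'X) ^+ k) U V =
  (a *: U + c *: V) ^+ m * (b *: U + d *: V) ^+ k.
Proof.
elim: k => [|k IH].
  rewrite addn0 !expr0 !mulr1; elim: m => [|m IH].
    by rewrite /homog big_ord1 !expr0 mulr1 coefC /= scale1r.
  by rewrite !exprSr homog_mul_lin ?IH // size_lin_exp.
by rewrite addnS !exprSr !mulrA homog_mul_lin ?IH // size_lin2_exp.
Qed.

(** Row [i] of [rho_mx N h] holds the coefficients of a form; evaluating it at the two linear forms
    of [g] gives row [i] for [g *m h]. Images of basis vectors stand in rows, whence the reversed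
    order. *)
Lemma rho_mxM N g h : rho_mx N (g *m h) = rho_mx N h *m rho_mx N g.
Proof.
apply/matrixP => i k; rewrite !mxE.
have mulE r s : (g *m h) r s = g r i0 * h i0 s + g r i1 * h i1 s.
  by rewrite !mxE big_ord_recl big_ord1 (_ : lift _ _ = i1) //; apply: val_inj.
have E s : ((g *m h) i0 s)%:P + ((g *m h) i1 s) *: 'X =
   h i0 s *: ((g i0 i0)%:P + g i1 i0 *: 'X)
   + h i1 s *: ((g i0 i1)%:P + g i1 i1 *: 'X) :> {poly K}.
  rewrite !mulE polyCD !polyCM -!mul_polyC !polyCD !polyCM; ring.
rewrite {1}/rho_poly !E -homog_lin_exp subnK; last by rewrite -ltnS.
rewrite /homog coef_sum; apply: eq_bigr => j _.
by rewrite coefZ !mxE.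
Qed.

Lemma rho_mx1 N : rho_mx N 1%:M = 1%:M.
Proof.
apply/matrixP => i j; rewrite !mxE /rho_poly !mxE /= scale0r addr0 expr1n.
by rewrite mul1r add0r scale1r coefXn eq_sym.
Qed.

Lemma rho_mx_diag N (a d : K) (i j : 'I_N.+1) :
  rho_mx N (\matrix_(r, s) if r == s then if r == i0 then a else d else 0) i j
  = (a ^+ (N - i) * d ^+ i) *+ (i == j).
Proof.
rewrite !mxE /rho_poly !mxE /= scale0r addr0 add0r exprZn -polyC_exp.
by rewrite mul_polyC scalerA coefZ coefXn eq_sym mulr_natr.
Qed.

End SymPower.

Lemma map_rho_mx (K L : comNzRingType) (f : {rmorphism K -> L}) N g :
  map_mx f (rho_mx N g) = rho_mx N (map_mx f g).
Proof.
apply/matrixP => i j; rewrite !mxE -coef_map /rho_poly rmorphM !rmorphXn /=.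
by rewrite !rmorphD /= !map_polyC !map_polyZ !map_polyX /= !mxE.
Qed.

Lemma rho_coefE N (g : 'M[int]_2) (i j : 'I_N.+1) :
  rho_coef g i j = rho_mx N g i j.
Proof. by rewrite mxE. Qed.

Lemma rho_mxX N (g : 'M[int]_2) m : rho_mx N (g ^+ m) = rho_mx N g ^+ m.
Proof.
elim: m => [|m IH]; first by rewrite !expr0 rho_mx1.
by rewrite exprSr rho_mxM IH exprS.
Qed.

Lemma SL2Z_inv (g : 'M[int]_2) : SL2Z g -> exists h, g *m h = 1%:M.
Proof. by move=> g1; exists (\adj g); rewrite mul_mx_adj g1. Qed.

(** The reversal in [rho_mxM] turns a right inverse of [g] into a left inverse of [rho_mx N g]. *)
Lemma rho_mx_inj N (g : 'M[int]_2) (l : 'cV_N.+1) : SL2Z g ->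
  rho_mx N g *m l = 0 -> l = 0.
Proof.
move=> /SL2Z_inv[h gh] gl.
by rewrite -[l]mul1mx -rho_mx1 -gh rho_mxM -mulmxA gl mulmx0.
Qed.

Lemma trace22 (K : comNzRingType) (h : 'M[K]_2) :
  \tr h = h i0 i0 + h i1 i1.
Proof.
by rewrite /mxtrace big_ord_recl big_ord1 (_ : lift _ _ = i1) //; apply: val_inj.
Qed.

Lemma det22 (K : comNzRingType) (h : 'M[K]_2) :
  \det h = h i0 i0 * h i1 i1 - h i0 i1 * h i1 i0.
Proof.
rewrite (expand_det_row _ i0) big_ord_recl big_ord1.
rewrite (_ : lift _ _ = i1); last by apply: val_inj.
rewrite /cofactor !det_mx11 !mxE /= expr0 expr1 mul1r.
rewrite (_ : lift _ _ = i1); last by apply: val_inj.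
rewrite (_ : lift _ _ = i0); last by apply: val_inj.
by rewrite mulN1r mulrN.
Qed.

Lemma matrix22P (K : comNzRingType) (g h : 'M[K]_2) :
  g i0 i0 = h i0 i0 -> g i0 i1 = h i0 i1 -> g i1 i0 = h i1 i0 ->
  g i1 i1 = h i1 i1 -> g = h.
Proof.
have I2 (i : 'I_2) : i = i0 \/ i = i1.
  by case: i => [[|[|//]] Hi]; [left | right]; apply: val_inj.
move=> e00 e01 e10 e11; apply/matrixP => i j.
by case: (I2 i) => ->; case: (I2 j) => ->.
Qed.

Lemma coef_lin_exp_top (K : comNzRingType) (a c : K) m :
  ((a%:P + c *: 'X) ^+ m)`_m = c ^+ m.
Proof.
elim: m => [|m IH]; first by rewrite !expr0 coefC.
rewrite exprSr mulrDr coefD coefMC nth_default ?size_lin_exp // mul0r add0r.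
by rewrite -scalerAr coefZ coefMX /= IH exprS.
Qed.

Lemma coef_lin_exp0 (K : comNzRingType) (a c : K) m :
  ((a%:P + c *: 'X) ^+ m)`_0 = a ^+ m.
Proof. by rewrite -horner_coef0 horner_exp !hornerE. Qed.

Lemma int_mul_eq1 (a d : int) : a * d = 1 -> (a = 1 /\ d = 1) \/ (a = -1 /\ d = -1).
Proof.
move=> ad; have /eqP : (`|a| * `|d|)%N = 1%N by rewrite -abszM ad.
rewrite muln_eq1 => /andP[/eqP a1 /eqP d1].
have [a1' | a1'] : a = 1 \/ a = -1 by lia.
  by left; split; rewrite // -ad a1' mul1r.
by right; split; rewrite // -[d]opprK -[- d]mulN1r -a1' ad.
Qed.

(** Three corner entries of [rho_mx N g] are N-th powers of entries of [g]. If the matrix is the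
    identity, they force [g] to be diagonal, hence 1 or -1; and -1 passes only for [N] even, where
    it is trivial in PSL_2(Z). *)
Lemma rho_mx_faithful N (g : 'M[int]_2) : (0 < N)%N -> SL2Z g ->
  nontrivial_in_Gn N.+1 g -> rho_mx N g <> 1%:M.
Proof.
move=> N0; rewrite /SL2Z det22 => g1 ntg gE.
have E (i j : 'I_N.+1) : (rho_poly N g i)`_j = (i == j)%:R.
  by move/matrixP: gE => /(_ i j); rewrite !mxE.
have ne : (ord0 == ord_max :> 'I_N.+1) = false.
  by apply/negbTE; rewrite -val_eqE /= eq_sym -lt0n.
have c0 : g i1 i0 = 0.
  have := E ord0 ord_max; rewrite /rho_poly subn0 expr0 mulr1 coef_lin_exp_top.
  rewrite ne => /eqP.
  by rewrite expf_eq0 => /andP[_ /eqP].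
have b0 : g i0 i1 = 0.
  have := E ord_max ord0; rewrite /rho_poly subnn expr0 mul1r coef_lin_exp0.
  rewrite eq_sym ne => /eqP.
  by rewrite expf_eq0 => /andP[_ /eqP].
have aN : g i0 i0 ^+ N = 1.
  by have := E ord0 ord0; rewrite /rho_poly subn0 expr0 mulr1 coef_lin_exp0.
rewrite b0 c0 mulr0 subr0 in g1.
have [[a1 d1]|[a1 d1]] :
    (g i0 i0 = 1 /\ g i1 i1 = 1) \/ (g i0 i0 = -1 /\ g i1 i1 = -1).
  exact: int_mul_eq1.
- have gI : g = 1 by apply: matrix22P; rewrite !mxE.
  by move: ntg; rewrite /nontrivial_in_Gn gI; case: ifP => _ // -[].
- have gI : g = -1 by apply: matrix22P; rewrite !mxE.
  have oN : odd N.+1.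
    move: aN; rewrite a1 -signr_odd /=; case: (odd N) => //.
  by move: ntg; rewrite /nontrivial_in_Gn gI oN => -[].
Qed.

(** * Dispersing sets of matrices *)

Definition dispersing N (S : set 'M[int]_2) : Prop :=
  forall K L : seq 'cV[int]_N.+1, exists2 g, S g &
    forall k l, k \in K -> l \in L -> l != 0 -> rho_mx N g *m l != k.

Lemma eventually_all (T : eqType) (P : T -> nat -> Prop) (s : seq T) :
  (forall t, exists M, forall m, (M <= m)%N -> P t m) ->
  exists M, forall m, (M <= m)%N -> forall t, t \in s -> P t m.
Proof.
move=> H; elim: s => [|t s [M1 HM1]]; first by exists 0%N.
have [M2 HM2] := H t; exists (maxn M1 M2) => m; rewrite geq_max => /andP[m1 m2].
by move=> u; rewrite inE => /orP[/eqP ->|us]; [apply: HM2 | apply: HM1].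
Qed.

(** Every pair of frequencies excludes only finitely many indices [m], so one large [m] serves all
    pairs from two finite lists. *)
Lemma dispersing_seq N (S : set 'M[int]_2) (g_ : nat -> 'M[int]_2) :
  (forall m, S (g_ m)) ->
  (forall k l : 'cV_N.+1, l != 0 ->
     exists M, forall m, (M <= m)%N -> rho_mx N (g_ m) *m l != k) ->
  dispersing N S.
Proof.
move=> Sg H K L.
pose P (kl : 'cV[int]_N.+1 * 'cV[int]_N.+1) (m : nat) :=
  kl.2 != 0 -> rho_mx N (g_ m) *m kl.2 != kl.1.
have [|M HM] := @eventually_all _ P [seq (k, l) | k <- K, l <- L].
  move=> [k l]; rewrite /P /=; have [->|l0] := eqVneq l 0; first by exists 0%N.
  by have [M HM] := H k l l0; exists M => m /HM.
exists (g_ M) => // k l kK lL l0; apply: (HM M (leqnn _) (k, l)) => //.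
by apply/allpairsP; exists (k, l).
Qed.

Lemma nat_roots_bounded (p : {poly int}) : p != 0 ->
  exists M, forall m, (M <= m)%N -> p.[m%:Z] != 0.
Proof.
elim: {p}(size p) {-2}p (leqnn (size p)) => [|s IH] p.
  by rewrite leqn0 size_poly_eq0 => /eqP -> /eqP.
move=> sp p0.
have [[m0 /eqP/factor_theorem[q pE]]|nr] := pselect (exists m0 : nat, p.[m0%:Z] = 0).
  have q0 : q != 0 by apply: contraNneq p0 => q0; rewrite pE q0 mul0r.
  have sq : (size q <= s)%N.
    by rewrite pE size_Mmonic ?monicXsubC // size_XsubC addn2 /= in sp.
  have [M HM] := IH q sq q0; exists (maxn M m0.+1) => m.
  rewrite geq_max => /andP[mM m0m]; rewrite pE hornerM mulf_neq0 ?HM //.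
  by rewrite !hornerE subr_eq0; apply/eqP; lia.
exists 0%N => m _; apply/eqP => e; apply: nr; exists m; exact: e.
Qed.

(* The first coordinate of the frequency [l] moved by the matrix with first
   column (1 + m^2, m) is a polynomial in m, of degree 2N - j where j is the
   least index of a nonzero entry of [l]; hence it leaves every finite set. *)
Lemma dispersing_SL2Z N : (0 < N)%N -> dispersing N SL2Z.
Proof.
move=> N0.
pose g_ (m : nat) : 'M[int]_2 := \matrix_(i, j)
  if i == i0 then (if j == i0 then 1 + m%:Z ^+ 2 else m%:Z)
  else (if j == i0 then m%:Z else 1).
apply: (@dispersing_seq _ _ g_).
  by move=> m; rewrite /SL2Z det22 !mxE /=; ring.
move=> k l l0.
(* By the binomial formula, entry [j] of the first row of [rho_mx N (g_ m)] is C(N, j) (1 + m^2)^(N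
   - j) m^j. *)
pose w (j : 'I_N.+1) : {poly int} := (1 + 'X^2) ^+ (N - j) * 'X^j.
pose p : {poly int} := \sum_(j < N.+1) (l j 0 *+ 'C(N, j)) *: w j.
have pE m : (rho_mx N (g_ m) *m l) ord0 0 = p.[m%:Z].
  rewrite mxE /p horner_sum; apply: eq_bigr => j _.
  rewrite !mxE /rho_poly subn0 expr0 mulr1 !mxE /= /w !hornerE.
  have jN : (j <= N)%N by rewrite -ltnS.
  rewrite exprDn coef_sum (bigD1 j) //= big1 ?addr0.
    rewrite coefMn exprZn -polyC_exp coefCM coefZ coefXn eqxx mulr1.
    by rewrite mulrC mulrnAr mulrA !mulrnAl.
  move=> i; rewrite -val_eqE /= => ij.
  by rewrite coefMn exprZn -polyC_exp coefCM coefZ coefXn eq_sym (negbTE ij) !mulr0 mul0rn.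
have [j0 lj0 j0min] : exists2 j, l j 0 != 0 & forall i, l i 0 != 0 -> (j <= i)%N.
  have /existsP[j lj] : [exists j, l j 0 != 0].
    apply: contraNT l0; rewrite negb_exists => /forallP H; apply/eqP/colP => j.
    by apply/eqP; rewrite mxE; have := H j; rewrite negbK.
  case: (@arg_minnP _ j (fun j => l j 0 != 0) (fun j => nat_of_ord j) lj) => i li imin.
  by exists i.
have sw (j : 'I_N.+1) : size (w j) = ((N - j).*2 + j).+1.
  have n0 : 1 + 'X^2 != 0 :> {poly int}.
    by rewrite -size_poly_eq0 addrC size_polyDl ?size_polyXn ?size_poly1.
  rewrite size_Mmonic ?monicXn ?expf_neq0 // size_polyXn.
  have := size_exp (1 + 'X^2 : {poly int}) (N - j).
  rewrite [in X in _ = X -> _]addrC size_polyDl ?size_polyXn ?size_poly1 //.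
  have : (0 < size ((1 + 'X^2 : {poly int}) ^+ (N - j))%R)%N.
    by rewrite size_poly_gt0 expf_neq0.
  by move: (size _); clear; lia.
have wm (j : 'I_N.+1) : w j \is monic.
  rewrite monicMr ?monicXn // monic_exp // monicE lead_coefE addrC.
  by rewrite size_polyDl ?size_polyXn ?size_poly1 // coefD coefXn coefC.
(* The degree 2N - j of [w j] decreases in [j], so only the least index [j0] with a nonzero entry
   reaches degree [d]. *)
pose d := ((N - j0).*2 + j0)%N.
have pd : p`_d != 0.
  rewrite coef_sum (bigD1 j0) //= big1 ?addr0.
    rewrite coefZ (_ : (w j0)`_d = 1) ?mulr1.
      by rewrite mulrn_eq0 negb_or lj0 andbT -lt0n bin_gt0 -ltnS.
    by have /eqP <- := wm j0; rewrite lead_coefE sw.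
  move=> j jj0; have [->|lj] := eqVneq (l j 0) 0; first by rewrite mul0rn scale0r coef0.
  have lt : (j0 < j)%N by rewrite ltn_neqAle eq_sym jj0 j0min.
  rewrite coefZ nth_default ?mulr0 // sw /d; have := ltn_ord j; lia.
(* As d = 2N - j0 >= N > 0, subtracting a constant leaves the coefficient at [d] intact. *)
have /nat_roots_bounded[M HM] : p - (k ord0 0)%:P != 0.
  apply/negP => /eqP/polyP/(_ d); rewrite coefB coefC coef0.
  have -> : (d == 0)%N = false by apply/eqP; rewrite /d; have := ltn_ord j0; lia.
  by rewrite subr0; exact/eqP.
exists M => m /HM; rewrite !hornerE subr_eq0 -pE; apply: contra => /eqP <-.
by [].
Qed.

(** Over the reals [h] is diagonalizable with eigenvalues la and 1 / la, where |la| <> 1. Hence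
    [rho_mx N h] has eigenvalues la^(N - 2 i); the exponents are nonzero because [N] is odd, so no
    positive power has the eigenvalue 1. *)
Lemma rho_mx_hyperbolic_fixed (R : realType) N (h : 'M[int]_2) (p : nat) (l : 'cV[int]_N.+1) :
  odd N -> SL2Z h -> hyperbolic h -> (0 < p)%N ->
  rho_mx N h ^+ p *m l = l -> l = 0.
Proof.
move=> oN; rewrite /SL2Z /hyperbolic det22 trace22 => h1 ht p0 fixl.
set a := h i0 i0 in h1 ht *; set b := h i0 i1 in h1 *.
set c := h i1 i0 in h1 *; set d := h i1 i1 in h1 ht *.
(* With c = 0 the diagonal entries would be both 1 or both -1, of trace 2 or -2. *)
have c0 : c != 0.
  apply/eqP => c0; have : a * d = 1 by rewrite -h1 c0 mulr0 subr0.
  by case/int_mul_eq1 => -[a1 d1]; rewrite a1 d1 in ht.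
pose t : R := (a + d)%:~R.
have t2 : 4 < t ^+ 2.
  rewrite /t -rmorphXn /= -[4]/(4%:~R) ltr_int.
  by move: ht; move: (a + d) => x; clear; nia.
pose q := Num.sqrt (t ^+ 2 - 4).
have q0 : 0 < q by rewrite sqrtr_gt0 subr_gt0.
have qq : q ^+ 2 = t ^+ 2 - 4 by rewrite sqr_sqrtr // subr_ge0 ltW.
pose la := (t + q) / 2; pose mu := (t - q) / 2.
have lm : la * mu = 1.
  have -> : la * mu = (t ^+ 2 - q ^+ 2) / 4 by rewrite /la /mu; field.
  by rewrite qq; field.
have lpm : la + mu = t by rewrite /la /mu; field.
(* An eigenvalue of absolute value 1 would equal its inverse, and then t^2 = 4. *)
have noone (x y : R) : x * y = 1 -> x + y = t -> `|x| != 1.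
  move=> xy xyt; apply/eqP => x1.
  have x2 : x ^+ 2 = 1 by rewrite -real_normK ?num_real // x1 expr1n.
  have yx : y = x by rewrite -[y]mul1r -x2 expr2 -mulrA xy mulr1.
  have tE : t ^+ 2 = 4 * x ^+ 2 by rewrite -xyt yx; ring.
  by move: t2; rewrite tE x2 mulr1 ltxx.
have nl := noone _ _ lm lpm.
have ml : mu * la = 1 by rewrite mulrC.
have pw (x y : R) (u w : nat) : x * y = 1 -> (u <= w)%N -> y ^+ (w - u) = x ^+ u * y ^+ w.
  move=> xy uw; rewrite -[in RHS](subnK uw) exprD mulrCA -exprMn xy expr1n.
  by rewrite mulr1.
have mpl : mu + la = t by rewrite addrC.
have nm := noone _ _ ml mpl.
pose hR := map_mx (intr : int -> R) h.
pose D (x y : R) : 'M[R]_2 := \matrix_(r, s) if r == s then if r == i0 then x else y else 0.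
(* The columns (x - d, c), for x = la and x = mu, are eigenvectors of [h]; c and q being nonzero,
   they are independent. *)
pose S : 'M[R]_2 := \matrix_(r, s)
  if r == i0 then (if s == i0 then la - d%:~R else mu - d%:~R) else c%:~R.
have Sdet : \det S = c%:~R * q.
  by rewrite det22 !mxE /= /la /mu; field.
have h1R : a%:~R * d%:~R - b%:~R * c%:~R = 1 :> R by rewrite -!intrM -intrB h1.
have hS : hR *m S = S *m D la mu.
  have mulE (A B : 'M[R]_2) r s : (A *m B) r s = A r i0 * B i0 s + A r i1 * B i1 s.
    by rewrite !mxE big_ord_recl big_ord1 (_ : lift _ _ = i1) //; apply: val_inj.
  have ch x y : x * y = 1 -> x + y = t -> a%:~R * (x - d%:~R) + b%:~R * c%:~R = (x - d%:~R) * x.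
    move=> xy xyt; have aE : a%:~R = x + y - d%:~R :> R by rewrite xyt /t intrD addrK.
    have -> : b%:~R * c%:~R = a%:~R * d%:~R - x * y by rewrite xy; lra.
    by rewrite aE; ring.
  apply: matrix22P; rewrite !mulE !mxE /= -/a -/b -/c -/d ?mulr0 ?addr0 ?add0r.
  - exact: ch lm lpm.
  - exact: ch ml mpl.
  - by rewrite mulrBr [d%:~R * _]mulrC subrK.
  - by rewrite mulrBr [d%:~R * _]mulrC subrK.
have [S' SS'] : exists S', S *m S' = 1%:M.
  exists (invmx S); rewrite mulmxV // unitmxE Sdet unitfE mulf_neq0 ?intr_eq0 //.
  exact: lt0r_neq0.
pose lR := map_mx (intr : int -> R) l.
pose v := rho_mx N S *m lR.
have RSh : rho_mx N S *m rho_mx N hR = rho_mx N (D la mu) *m rho_mx N S.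
  by rewrite -!rho_mxM hS.
have RShp : rho_mx N S *m rho_mx N hR ^+ p = rho_mx N (D la mu) ^+ p *m rho_mx N S.
  elim: p {p0 fixl} => [|p IH]; first by rewrite !expr0 mulmx1 mul1mx.
  by rewrite !exprSr mulmxA IH -mulmxA RSh mulmxA.
have vfix : rho_mx N (D la mu) ^+ p *m v = v.
  rewrite /v mulmxA -RShp -mulmxA; congr (_ *m _).
  rewrite /lR /hR -map_rho_mx -[in RHS]fixl map_mxM; congr (_ *m _).
  elim: p {p0 fixl RShp} => [|p IH]; first by rewrite !expr0 map_mx1.
  by rewrite !exprSr map_mxM IH.
have DE : rho_mx N (D la mu) = diag_mx (\row_i (la ^+ (N - i) * mu ^+ i)).
  by apply/matrixP => i j; rewrite rho_mx_diag !mxE.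
have v0 : v = 0.
  apply/colP => i; rewrite !mxE.
  have : (rho_mx N (D la mu) ^+ p *m v) i 0 = (la ^+ (N - i) * mu ^+ i) ^+ p * v i 0.
    elim: p {p0 fixl RShp vfix} => [|p IH]; first by rewrite !expr0 mul1mx mul1r.
    rewrite !exprS -mulmxA DE mul_diag_mx mxE [X in X * _]mxE -DE IH.
    by rewrite mulrA.
  rewrite vfix => /eqP; rewrite -subr_eq0 -{1}[v i 0]mul1r -mulrBl mulf_eq0.
  case/orP; last by rewrite [v i 0]mxE => /eqP.
  have iN : (i <= N)%N by rewrite -ltnS.
  have ne : (N - i)%N != i by apply/eqP; lia.
  rewrite subr_eq0 eq_sym => /eqP e1; exfalso.
  have npow x k : (0 < k)%N -> `|x| != 1 -> x ^+ k != 1 :> R.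
    move=> k0; apply: contra => /eqP xk.
    by rewrite -(@pexpr_eq1 _ _ k) // -normrX xk normr1.
  (* Exponents are natural numbers, so la mu = 1 is used to cancel the smaller of the two powers. *)
  case: (ltngtP (N - i)%N i) ne => // [lt _|gt _].
    have := npow mu ((i - (N - i)) * p)%N.
    rewrite muln_gt0 subn_gt0 lt p0 => /(_ isT nm)/eqP; apply.
    rewrite exprM -[RHS]e1; congr (_ ^+ _).
    by rewrite (pw _ _ _ _ lm) // ltnW.
  have := npow la ((N - i - i) * p)%N; rewrite muln_gt0 subn_gt0 gt p0 => /(_ isT nl)/eqP; apply.
  rewrite exprM -[RHS]e1; congr (_ ^+ _).
  by rewrite mulrC; apply: (pw _ _ _ _ ml); exact: ltnW.
have lR0 : lR = 0.
  by rewrite -[lR]mul1mx -rho_mx1 -SS' rho_mxM -mulmxA -/v v0 mulmx0.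
apply/colP => i; move/colP: lR0 => /(_ i); rewrite !mxE => /eqP.
by rewrite intr_eq0 => /eqP.
Qed.

Lemma SL2ZX (h : 'M[int]_2) m : SL2Z h -> SL2Z (h ^+ m).
Proof.
rewrite /SL2Z => h1; elim: m => [|m IH]; first by rewrite expr0 det1.
by rewrite exprS det_mulmx IH h1 mul1r.
Qed.

(** The orbit of a nonzero [l] under the powers of [h] meets [k] at most once: after cancelling the
    earlier power, a second visit would make [l] fixed by a positive power of [h]. *)
Lemma dispersing_hyperbolic (R : realType) N (h : 'M[int]_2) : odd N -> SL2Z h ->
  hyperbolic h -> dispersing N [set h ^+ m | m in [set: nat]].
Proof.
move=> oN h1 hh; apply: (@dispersing_seq _ _ (fun m => h ^+ m)).
  by move=> m; exists m.
move=> k l l0.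
have [[m0 Em0]|nex] := pselect (exists m, rho_mx N (h ^+ m) *m l = k); last first.
  by exists 0%N => m _; apply/eqP => e; apply: nex; exists m.
exists m0.+1 => m m0m; apply/eqP => Em; move/eqP: l0; apply.
apply: (@rho_mx_hyperbolic_fixed R N h (m - m0)) => //; first by rewrite subn_gt0.
apply/eqP; rewrite -subr_eq0; apply/eqP; apply: (rho_mx_inj (g := h ^+ m0)).
  exact: SL2ZX.
rewrite mulmxBr Em0 -Em !rho_mxX mulmxA -[X in (X *m l) - _]exprD subnKC ?subrr //.
exact: ltnW.
Qed.

(** * Trigonometric polynomials *)

Section TrigPolynomials.
Variable R : realType.

Definition cs (t : R) : R := cos (2 * pi * t).

Lemma cs0 : cs 0 = 1. Proof. by rewrite /cs mulr0 cos0. Qed.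

Lemma csN t : cs (- t) = cs t. Proof. by rewrite /cs mulrN cosN. Qed.

Lemma cs_geN1 t : -1 <= cs t. Proof. exact: cos_geN1. Qed.

Lemma csM a b : cs a * cs b = (cs (a + b) + cs (a - b)) / 2.
Proof. by rewrite /cs (mulrDr _ a b) (mulrBr _ a b) cosD cosB; field. Qed.

Lemma csDn t (n : nat) : cs (t + n%:R) = cs t.
Proof.
elim: n => [|n IH]; first by rewrite addr0.
rewrite -natr1 addrA -IH /cs mulrDr mulr1 -[RHS]cosD2pi; congr cos.
by rewrite mulr_natl.
Qed.

Lemma csDz t (z : int) : cs (t + z%:~R) = cs t.
Proof.
case: z => n; first exact: csDn.
by rewrite NegzE mulrNz -(csDn _ n.+1) subrK.
Qed.

Lemma csDint t z : z \is a Num.int -> cs (t + z) = cs t.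
Proof. by move=> /intrP[m ->]; exact: csDz. Qed.

(** [cs] decreases on [0, 1/2] and is symmetric about 1/2. *)
Lemma cs_decr (d t : R) : 0 <= d <= 1 / 2 -> d <= t <= 1 - d -> cs t <= cs d.
Proof.
have mono (a b : R) : 0 <= a -> a <= b -> b <= 1 / 2 -> cs b <= cs a.
  move=> a0 ab b2; rewrite /cs.
  have pi0 := pi_gt0 R.
  have inI (x : R) : 0 <= x -> x <= 1 / 2 -> 2 * pi * x \in `[0, pi].
    move=> x0 x2; rewrite in_itv /=; apply/andP; split.
      by rewrite !mulr_ge0 // ltW.
    by rewrite -[leRHS]mulr1 -mulrA mulrCA ler_pM2l //; lra.
  rewrite leNgt ltr_cos ?inI //; try lra.
  by rewrite -leNgt ler_pM2l // mulr_gt0.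
move=> /andP[d0 d2] /andP[dt td].
have [t2|t2] := leP t (1 / 2); first exact: mono.
have <- : cs (1 - t) = cs t.
  by rewrite -csN opprB -[X in _ - X]/(1%:~R) -mulrNz csDz.
by apply: mono => //; lra.
Qed.

Lemma cs_lt1 t : 0 < t < 1 -> cs t < 1.
Proof.
move=> /andP[t0 t1].
pose d := Num.min t (1 - t).
have d0 : 0 < d by rewrite /d lt_min t0 subr_gt0.
have dt : d <= t by rewrite /d ge_min lexx.
have dt' : d <= 1 - t by rewrite /d ge_min lexx orbT.
have d2 : d <= 1 / 2 by lra.
have le : cs t <= cs d by apply: cs_decr; apply/andP; split; lra.
apply: (le_lt_trans le).
rewrite -cs0 /cs mulr0 ltr_cos; rewrite ?in_itv /= ?lexx ?pi_ge0 //.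
  by rewrite !mulr_gt0 // pi_gt0.
rewrite mulr_ge0 ?mulr_ge0 ?pi_ge0 ?(ltW d0) //=.
by rewrite -[leRHS]mulr1 -mulrA mulrCA ler_pM2l ?pi_gt0 //; lra.
Qed.

(** A grid with [M] points per period detects every nonzero frequency below [M]. *)
Lemma cs_frac_neq1 (k : int) (M : nat) : k != 0 -> (`|k| < M)%N ->
  cs (k%:~R / M%:R) != 1.
Proof.
move=> k0 kM; rewrite lt_eqF //.
have M0 : (0 : R) < M%:R by rewrite ltr0n; lia.
have -> : cs (k%:~R / M%:R) = cs (`|k|%N%:R / M%:R).
  case: (k) => // n.
  by rewrite NegzE abszN mulrNz mulNr csN.
apply: cs_lt1; rewrite divr_gt0 ?ltr0n ?absz_gt0 //=; last by lia.
by rewrite ltr_pdivrMr // mul1r ltr_nat.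
Qed.

Lemma cs_lipschitz a b : `|cs a - cs b| <= 2 * pi * `|a - b|.
Proof.
wlog ab : a b / a <= b => [H|].
  have [/H//|/ltW/H] := leP a b.
  by rewrite (distrC (cs a)) (distrC a).
have P0 : 0 <= 2 * pi :> R by rewrite mulr_ge0 // pi_ge0.
have pab : 2 * pi * a <= 2 * pi * b by apply: ler_wpM2l.
rewrite (distrC (cs a)) (distrC a).
have [c _ ->] : exists2 c, c \in `[2 * pi * a, 2 * pi * b]%R &
    cs b - cs a = (- sin c) * (2 * pi * b - 2 * pi * a).
  apply: (@MVT_segment R (@cos R) (fun x => - sin x)) => //.
  by apply: continuous_subspaceT => x; exact: continuous_cos.
rewrite -mulrBr normrM normrN normrM (ger0_norm P0).
by rewrite ler_piMl ?sin_max // mulr_ge0.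
Qed.

Section Freq.
Variable V : zmodType.

(* An entry [(c, k, th)] stands for the function [c cos (2 pi (k + th))]; the
   additive map [e] sends a frequency [k] to its value at a point. *)
Definition tev (e : V -> R) (s : seq (R * V * R)) : R :=
  \sum_(t <- s) t.1.1 * cs (e t.1.2 + t.2).

(** An entry of frequency 0 is a constant; one of nonzero frequency averages to 0 over a period. *)
Definition tmean (s : seq (R * V * R)) : R :=
  \sum_(t <- s | t.1.2 == 0) t.1.1 * cs t.2.

(** The product-to-sum formula [csM] keeps products in the form of lists, from which the mean is
    read off. *)
Definition tmul (s s' : seq (R * V * R)) : seq (R * V * R) :=
  [seq (t.1.1 * u.1.1 / 2, t.1.2 + u.1.2, t.2 + u.2) | t <- s, u <- s'] ++
  [seq (t.1.1 * u.1.1 / 2, t.1.2 - u.1.2, t.2 - u.2) | t <- s, u <- s'].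

Definition tscale (a : R) (s : seq (R * V * R)) : seq (R * V * R) :=
  [seq (a * t.1.1, t.1.2, t.2) | t <- s].

Lemma tev_scale e a s : tev e (tscale a s) = a * tev e s.
Proof.
by rewrite /tev big_map mulr_sumr; apply: eq_bigr => t _ /=; rewrite mulrA.
Qed.

Lemma tmean_scale a s : tmean (tscale a s) = a * tmean s.
Proof.
by rewrite /tmean big_map mulr_sumr; apply: eq_bigr => t _ /=; rewrite mulrA.
Qed.

Lemma tev_cat e s s' : tev e (s ++ s') = tev e s + tev e s'.
Proof. exact: big_cat. Qed.

Lemma tmean_cat s s' : tmean (s ++ s') = tmean s + tmean s'.
Proof. exact: big_cat. Qed.

Lemma tev_flatten e ss : tev e (flatten ss) = \sum_(s <- ss) tev e s.
Proof.
elim: ss => [|s ss IH]; first by rewrite /tev !big_nil.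
by rewrite /= tev_cat IH big_cons.
Qed.

Lemma tmean_flatten ss : tmean (flatten ss) = \sum_(s <- ss) tmean s.
Proof.
elim: ss => [|s ss IH]; first by rewrite /tmean !big_nil.
by rewrite /= tmean_cat IH big_cons.
Qed.

Lemma tev_mul (e : V -> R) s s' : {morph e : a b / a + b} ->
  tev e (tmul s s') = tev e s * tev e s'.
Proof.
move=> eD.
have e0 : e 0 = 0 by apply: (addrI (e 0)); rewrite -eD !addr0.
have eB a b : e (a - b) = e a - e b by apply: (addIr (e b)); rewrite -eD !subrK.
rewrite tev_cat /tev !big_allpairs_dep /= -big_split /= mulr_suml.
apply: eq_bigr => t _; rewrite -big_split /= mulr_sumr.
apply: eq_bigr => u _; rewrite mulrACA csM eD eB.
have -> : e t.1.2 + t.2 - (e u.1.2 + u.2) = e t.1.2 - e u.1.2 + (t.2 - u.2) by ring.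
have -> : e t.1.2 + t.2 + (e u.1.2 + u.2) = e t.1.2 + e u.1.2 + (t.2 + u.2) by ring.
by field.
Qed.

(** Each pair of cosines produces both the sum and the difference of its frequencies, and either may
    create a constant. *)
Definition non_resonant (s s' : seq (R * V * R)) : Prop :=
  forall t u, t \in s -> u \in s' ->
    t.1.2 + u.1.2 = 0 \/ t.1.2 - u.1.2 = 0 -> t.1.2 = 0 /\ u.1.2 = 0.

(** Without resonance, frequency 0 in the product arises only from two zero frequencies, and for
    these [csM] recombines the two halves. *)
Lemma tmean_mul s s' : non_resonant s s' ->
  tmean (tmul s s') = tmean s * tmean s'.
Proof.
move=> nr; rewrite tmean_cat /tmean.
rewrite [X in X + _]big_mkcond [X in _ + X]big_mkcond.
rewrite !big_allpairs_dep /= -big_split /= [X in _ = X * _]big_mkcond.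
rewrite [X in _ = _ * X]big_mkcond mulr_suml.
apply: eq_big_seq => t ts; rewrite -big_split /= mulr_sumr.
apply: eq_big_seq => u us; have := nr t u ts us.
have [t0|t0] := eqVneq t.1.2 0; have [u0|u0] := eqVneq u.1.2 0 => H.
- by rewrite t0 u0 subr0 addr0 eqxx mulrACA csM; field.
- rewrite mulr0; case: eqP => [/or_introl/H[_ /eqP]|_]; first by rewrite (negbTE u0).
  by case: eqP => [/or_intror/H[_ /eqP]|_]; rewrite ?(negbTE u0) // addr0.
- rewrite mul0r; case: eqP => [/or_introl/H[/eqP]|_]; first by rewrite (negbTE t0).
  by case: eqP => [/or_intror/H[/eqP]|_]; rewrite ?(negbTE t0) // addr0.
- rewrite mul0r; case: eqP => [/or_introl/H[/eqP]|_]; first by rewrite (negbTE t0).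
  by case: eqP => [/or_intror/H[/eqP]|_]; rewrite ?(negbTE t0) // addr0.
Qed.

(* The sum [S th] of [cs (w j + th)] is invariant under [th -> th +- b], while
   [S (th + b) + S (th - b) = 2 cs b * S th]. *)
Lemma sum_cs_eq0 (J : finType) (sig : J -> J) (w : J -> R) (b th : R) :
  injective sig -> (forall j, exists z : int, w (sig j) = w j + b + z%:~R) ->
  cs b != 1 -> \sum_j cs (w j + th) = 0.
Proof.
move=> sinj wsig b1; pose S th := \sum_j cs (w j + th).
have SD t : S t = S (t + b).
  rewrite /S (reindex_inj sinj) /=; apply: eq_bigr => j _.
  have [z ->] := wsig j.
  by rewrite -[RHS](csDz _ z); congr cs; ring.
have : S (th + b) + S (th - b) = 2 * cs b * S th.
  rewrite /S -big_split mulr_sumr; apply: eq_bigr => j _ /=.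
  by rewrite mulrAC -mulrA csM !addrA; field.
rewrite -SD [S (th - b)]SD subrK -/(S th) => /eqP.
have -> : S th + S th = 2 * S th by ring.
rewrite -subr_eq0 -mulrBl mulf_eq0 => /orP[|/eqP//].
have -> : 2 - 2 * cs b = 2 * (1 - cs b) by ring.
by rewrite mulf_eq0 pnatr_eq0 /= subr_eq0 eq_sym (negbTE b1).
Qed.

(** Finite averages replace integrals. Here [w] is a family of translations and [o] a common offset;
    each nonzero frequency has a permutation of [J] that shifts its phase by a fixed non-integer, so
    its terms cancel. *)
Lemma sum_tev (J : finType) (o : V -> R) (w : J -> V -> R) s :
  (forall j, w j 0 = 0) -> o 0 = 0 ->
  (forall t, t \in s -> t.1.2 != 0 -> exists (sig : J -> J) (b : R),
     [/\ injective sig, cs b != 1 &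
       forall j, exists z : int, w (sig j) t.1.2 = w j t.1.2 + b + z%:~R]) ->
  \sum_j tev (fun k => o k + w j k) s = #|J|%:R * tmean s.
Proof.
move=> w0 o0 H; rewrite exchange_big /tmean [X in _ * X]big_mkcond mulr_sumr /=.
apply: eq_big_seq => t ts.
have [t0|t0] := eqVneq t.1.2 0.
  under eq_bigr => j _ do rewrite t0 w0 o0 !add0r.
  by rewrite sumr_const mulr_natl.
rewrite mulr0 -mulr_sumr; under eq_bigr => j _ do rewrite addrAC addrC.
have [sig [b [sinj b1 wsig]]] := H t ts t0.
by rewrite (sum_cs_eq0 _ sinj wsig b1) mulr0.
Qed.

End Freq.

Definition tmap (V W : zmodType) (f : V -> W) (s : seq (R * V * R)) :
  seq (R * W * R) := [seq (t.1.1, f t.1.2, t.2) | t <- s].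

Lemma tev_map (V W : zmodType) (f : V -> W) e s :
  tev e (tmap f s) = tev (e \o f) s.
Proof. by rewrite /tev big_map. Qed.

Lemma tmean_map (V W : zmodType) (f : V -> W) s :
  (forall v, (f v == 0) = (v == 0)) -> tmean (tmap f s) = tmean s.
Proof. by move=> f0; rewrite /tmean big_map; apply: eq_bigl => t /=. Qed.

(** Wrapping around from [M] to 0 changes the phase by the integer [- k]. *)
Lemma ordS_shift M (k : int) (j : 'I_M.+1) : exists z : int,
  k%:~R * (ordS j)%:R / M.+1%:R = k%:~R * j%:R / M.+1%:R + k%:~R / M.+1%:R + z%:~R :> R.
Proof.
exists (- (k * ((j.+1 %/ M.+1)%N : int))).
have M0 : M.+1%:R != 0 :> R by rewrite pnatr_eq0.
have E : (ordS j : nat)%:R = j%:R + 1 - (j.+1 %/ M.+1)%N%:R * M.+1%:R :> R.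
  by rewrite natr1 [in j.+1%:R](divn_eq j.+1 M.+1) natrD natrM addrAC subrr add0r.
by rewrite E mulrNz intrM; field.
Qed.

(** * Cosine kernels and majorants of intervals *)

Definition lin1 (u : R) (k : int) : R := k%:~R * u.

Lemma lin1D u : {morph lin1 u : a b / a + b}.
Proof. by move=> a b; rewrite /lin1 intrD mulrDl. Qed.

(** The kernel ((1 + cs u) / 2)^N as an explicit list: nonnegative, of degree at most [N], equal to
    1 at integers and small far from them. *)
Definition cos_ker (N : nat) : seq (R * int * R) :=
  iter N (fun s => tmul s [:: (1 / 2, 0, 0); (1 / 2, 1, 0)]) [:: (1, 0, 0)].

Lemma tev_cos_ker N u : tev (lin1 u) (cos_ker N) = ((1 + cs u) / 2) ^+ N.
Proof.
elim: N => [|N IH].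
  by rewrite /tev big_seq1 /lin1 /= mul0r addr0 cs0 mulr1 expr0.
rewrite /cos_ker iterS -/(cos_ker N) tev_mul; last exact: lin1D.
rewrite IH exprSr; congr (_ * _).
rewrite /tev big_cons big_seq1 /lin1 /= mul0r !addr0 cs0 mulr1 mul1r.
by rewrite mul1r; field.
Qed.

Lemma cos_ker_freq N t : t \in cos_ker N -> (`|t.1.2| <= N)%N.
Proof.
elim: N t => [|N IH] t; first by rewrite inE => /eqP ->.
rewrite /cos_ker iterS -/(cos_ker N) mem_cat => /orP[] /allpairsP[[a b] /=].
  case=> /IH; move: (a.1.2) => z aN.
  by rewrite !inE => /orP[] /eqP -> -> /=; rewrite ?addr0; lia.
case=> /IH; move: (a.1.2) => z aN.
by rewrite !inE => /orP[] /eqP -> -> /=; rewrite ?subr0; lia.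
Qed.

(** Since [N.+1] points suffice for degree [N], the sum over the shifted grid does not depend on
    [v]. *)
Lemma cos_ker_sum N v :
  \sum_(j < N.+1) ((1 + cs (v + j%:R / N.+1%:R)) / 2) ^+ N
  = N.+1%:R * tmean (cos_ker N).
Proof.
transitivity (#|'I_N.+1|%:R * tmean (cos_ker N)); last by rewrite card_ord.
rewrite -(@sum_tev _ _ (lin1 v) (fun (j : 'I_N.+1) k => lin1 ((j : nat)%:R / N.+1%:R) k)).
- apply: eq_bigr => j _; rewrite -tev_cos_ker; apply: eq_bigr => t _.
  by rewrite /lin1 mulrDr.
- by move=> j; rewrite /lin1 mul0r.
- by rewrite /lin1 mul0r.
move=> t ts t0; exists (@ordS N.+1), (t.1.2%:~R / N.+1%:R); split.
- exact: can_inj (@ordSK _).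
- by rewrite cs_frac_neq1 // ltnS cos_ker_freq.
- move=> j; have [z zE] := ordS_shift t.1.2 j; exists z.
  by rewrite /lin1 !mulrA.
Qed.

Lemma cos_ker_mean N : 1 <= N.+1%:R * tmean (cos_ker N).
Proof.
rewrite -(cos_ker_sum N 0) big_ord_recl /= mul0r addr0 cs0.
have -> : (1 + 1) / 2 = 1 :> R by field.
rewrite expr1n lerDl sumr_ge0 // => i _.
by rewrite exprn_ge0 // divr_ge0 // -lerBlDl sub0r cs_geN1.
Qed.

Lemma exp_small (q e1 e2 : R) : 0 <= q < 1 -> 0 < e1 -> 0 < e2 ->
  exists N : nat, N.+1%:R * q ^+ N <= e1 /\ N.+1%:R^-1 <= e2.
Proof.
move=> /andP[q0 q1] e10 e20.
(* In q^N = s^N s^N one factor absorbs [N], by comparison with the geometric sum, and the other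
   tends to 0. *)
pose s := Num.sqrt q.
have s0 : 0 <= s by exact: sqrtr_ge0.
have qE : q = s ^+ 2 by rewrite sqr_sqrtr.
have s1 : s < 1 by rewrite -(@ltr_pXn2r _ 2) ?nnegrE // -qE expr1n.
have bern N : N%:R * s ^+ N * (1 - s) <= 1.
  have -> : N%:R * s ^+ N = \sum_(i < N) s ^+ N.
    by rewrite sumr_const card_ord mulr_natl.
  apply: (@le_trans _ _ ((\sum_(i < N) s ^+ i) * (1 - s))).
    rewrite ler_pM2r ?subr_gt0 //; apply: ler_sum => i _.
    by rewrite ler_wiXn2l ?(ltW s1) // ltnW.
  rewrite mulrC -opprB mulNr -subrX1 opprB gerBl.
  exact: exprn_ge0.
have c : s ^+ n @[n --> \oo] --> (0 : R).
  by apply: cvg_expr; rewrite ger0_norm.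
pose C := (1 - s)^-1 + 1.
have C0 : 0 < C by rewrite addr_gt0 ?invr_gt0 ?subr_gt0.
have /cvgrPdist_lt/(_ (e1 / C) (divr_gt0 e10 C0)) [N1 _ H1] := c.
pose N := maxn N1 (Num.truncn e2^-1).+1.
exists N; split.
  have := H1 N (leq_maxl _ _); rewrite sub0r normrN ger0_norm ?exprn_ge0 //.
  rewrite ltr_pdivlMr // => /ltW; apply: le_trans.
  rewrite qE exprAC expr2 mulrA [leRHS]mulrC ler_wpM2r ?exprn_ge0 //.
  rewrite -natr1 mulrDl mul1r lerD //.
    by rewrite -[leRHS]mul1r ler_pdivlMr ?subr_gt0.
  by rewrite exprn_ile1 // ltW.
rewrite invf_ple ?posrE ?ltr0n //.
apply: ltW; apply: (lt_trans (truncnS_gt _)); rewrite ltr_nat.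
by rewrite ltnS; exact: leq_maxr.
Qed.

(* Riemann sum, over the grid points close to [[al, be]], of translates of the
   normalised kernel [((1 + cs) / 2)^N], slightly rescaled. *)
Lemma interval_majorant (al be ep : R) : 0 < ep ->
  exists s : seq (R * int * R),
  [/\ forall u, 0 <= tev (lin1 u) s,
      forall u (z : int), al <= u - z%:~R <= be -> 1 <= tev (lin1 u) s &
      tmean s <= Num.max (be - al) 0 + ep].
Proof.
move=> ep0; have [albe|beal] := leP al be; last first.
  exists [::]; split => [u|u z /andP[h1 h2]|]; rewrite /tev /tmean ?big_nil //.
    by have := le_lt_trans (le_trans h1 h2) beal; rewrite ltxx.
  by rewrite addr_ge0 ?(ltW ep0) // le_max lexx orbT.
pose ell := be - al.
have ell0 : 0 <= ell by rewrite subr_ge0.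
have -> : Num.max (be - al) 0 = ell by apply/max_idPl.
(* [de] widens the interval on both sides, at a cost of at most ep / 4 in length. *)
pose de := Num.min (1 / 4) (ep / 8).
have de0 : 0 < de by rewrite /de lt_min; apply/andP; split; lra.
have de4 : de <= 1 / 4 by rewrite /de ge_min lexx.
have de8 : de <= ep / 8 by rewrite /de ge_min lexx orbT.
(* [q] bounds the base of the kernel at distance at least [de] from the integers. *)
pose q := (1 + cs de) / 2.
have q01 : 0 <= q < 1.
  have := cs_geN1 de; have : cs de < 1 by apply: cs_lt1; lra.
  by rewrite /q; lra.
have le0 : 0 < ell + ep by lra.
(* [eta] is the admissible relative loss of kernel mass; it uses up ep / 4 of the final bound. *)
pose eta := ep / (4 * (ell + ep)).
have eta0 : 0 < eta by rewrite divr_gt0 // mulr_gt0.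
have etaE : eta * (ell + ep) = ep / 4.
  by rewrite /eta; field; rewrite lt0r_neq0.
have eta1 : eta < 1.
  by rewrite /eta ltr_pdivrMr ?mulr_gt0 // mul1r; lra.
have [N [HN1 HN2]] := @exp_small q eta (ep / 8) q01 eta0 ltac:(lra).
pose M : R := N.+1%:R.
have M0 : 0 < M by rewrite ltr0n.
pose cN := tmean (cos_ker N).
have McN : 1 <= M * cN := cos_ker_mean N.
have cN0 : 0 < cN by rewrite -(pmulr_rgt0 _ M0) (lt_le_trans _ McN).
(* The grid indices a0, ..., a0 + L - 1 run from the floor of M (al - de) to the floor of M (be +
   de), both included. *)
pose a0 : int := Num.floor (M * (al - de)).
pose L : nat := `|(Num.floor (M * (be + de)) + 1 - a0)%R|%N.
have a0le : a0%:~R <= M * (al - de) by exact: floor_le_tmp.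
have a0gt : M * (al - de) < a0%:~R + 1 by rewrite -[1]/(1%:~R) -intrD; exact: floorD1_gt.
have fle : (Num.floor (M * (be + de)))%:~R <= M * (be + de) by exact: floor_le_tmp.
have fgt : M * (be + de) < (Num.floor (M * (be + de)))%:~R + 1.
  by rewrite -[1]/(1%:~R) -intrD; exact: floorD1_gt.
have LE : L%:R = (Num.floor (M * (be + de)))%:~R + 1 - a0%:~R :> R.
  rewrite /L pmulrn gez0_abs; first by rewrite rmorphB rmorphD.
  rewrite subr_ge0 -(ler_int R) rmorphD /=; apply: ltW.
  apply: (le_lt_trans a0le); apply: (lt_trans _ fgt).
  by rewrite ltr_pM2l //; lra.
have Lle : L%:R <= M * (ell + 2 * de) + 2.
  rewrite LE /ell; move: fle a0gt; rewrite !mulrDr !mulrN; lra.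
pose kap := (M * cN * (1 - eta))^-1.
have kap0 : 0 < kap by rewrite invr_gt0 !mulr_gt0 // subr_gt0.
pose K v := ((1 + cs v) / 2) ^+ N.
have K0 v : 0 <= K v.
  by rewrite /K exprn_ge0 // divr_ge0 // -lerBlDl sub0r cs_geN1.
(* Lowering the phase by k c translates the kernel to the centre c = (a0 + t) / M. *)
pose shf (t : nat) : seq (R * int * R) :=
  [seq (w.1.1, w.1.2, w.2 - w.1.2%:~R * ((a0%:~R + t%:R) / M)) | w <- cos_ker N].
have shfE t u : tev (lin1 u) (shf t) = K (a0%:~R / M - u + t%:R / M).
  rewrite /K -(csN (_ + _)) -tev_cos_ker /tev big_map; apply: eq_bigr => w _ /=.
  congr (_ * cs _); rewrite /lin1; field.
  by rewrite lt0r_neq0.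
have shfm t : tmean (shf t) = cN.
  rewrite /cN /tmean big_map; apply: eq_bigr => w /= /eqP ->.
  by rewrite mul0r subr0.
pose s := tscale kap (flatten [seq shf t | t <- iota 0 L]).
have sE u : tev (lin1 u) s = kap * \sum_(0 <= t < L) K (a0%:~R / M - u + t%:R / M).
  rewrite tev_scale tev_flatten big_map /index_iota subn0; congr (_ * _).
  by apply: eq_bigr => t _; rewrite shfE.
exists s; split.
- by move=> u; rewrite sE mulr_ge0 ?(ltW kap0) // sumr_ge0.
- move=> u z uz.
  have -> : tev (lin1 u) s = tev (lin1 (u - z%:~R)) s.
    apply: eq_bigr => t _; congr (_ * _).
    rewrite -(csDz _ (- (t.1.2 * z))); congr cs.
    by rewrite /lin1 mulrNz intrM; ring.
  move: (u - z%:~R) uz => {}u /andP[alu ube].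
  rewrite sE /kap mulrC ler_pdivlMr ?mul1r; last by rewrite -invr_gt0.
  have full : \sum_(0 <= t < N.+1) K (a0%:~R / M - u + t%:R / M) = M * cN.
    by rewrite big_mkord cos_ker_sum.
  (* More than a full period of grid points carries the whole mass M cN. Otherwise, completing the
     period adds points at distance at least [de] from [u] modulo 1, each weighing at most q^N. *)
  have [LN|NL] := leqP L N.+1; last first.
    apply: (@le_trans _ _ (M * cN)).
      by rewrite ler_piMr ?mulr_ge0 ?(ltW M0) ?(ltW cN0) //; lra.
    rewrite -full [leRHS](big_cat_nat (n := N.+1)) ?(ltnW NL) //=.
    by rewrite lerDl sumr_ge0.
  move: full; rewrite (big_cat_nat (n := L)) //= => full.
  suff tail : \sum_(L <= t < N.+1) K (a0%:~R / M - u + t%:R / M) <= M * cN * eta.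
    by move: full tail; rewrite mulrBr mulr1; lra.
  apply: (@le_trans _ _ (\sum_(L <= t < N.+1) q ^+ N)).
    rewrite big_nat_cond [leRHS]big_nat_cond; apply: ler_sum => t.
    rewrite andbT => /andP[Lt tN].
    apply: lerXn2r; rewrite ?nnegrE.
    + by rewrite divr_ge0 // -lerBlDl sub0r cs_geN1.
    + by case/andP: q01.
    rewrite ler_pM2r // lerD2l; apply: cs_decr; first by lra.
    have -> : a0%:~R / M - u + t%:R / M = (a0%:~R + t%:R) / M - u.
      by rewrite mulrDl; ring.
    have tL : L%:R <= t%:R :> R by rewrite ler_nat.
    have tN' : t%:R + 1 <= M by rewrite natr1 ler_nat.
    apply/andP; split.
      rewrite lerBrDr ler_pdivlMr // mulrC.
      have : M * (de + u) <= M * (be + de) by rewrite ler_pM2l //; lra.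
      by move: LE tL fgt; lra.
    rewrite lerBlDr ler_pdivrMr // mulrC.
    have : M * (al - de) <= M * (1 - de + u - 1) by rewrite ler_pM2l //; lra.
    by rewrite [M * (1 - de + u - 1)]mulrBr mulr1; move: a0le tN'; lra.
  rewrite sumr_const_nat -mulr_natl.
  apply: (@le_trans _ _ (M * q ^+ N)).
    rewrite ler_wpM2r ?exprn_ge0 //; first by case/andP: q01.
    by rewrite ler_nat leq_subr.
  apply: (le_trans HN1).
  by rewrite -[leLHS]mul1r ler_pM2r.
- rewrite tmean_scale tmean_flatten big_map.
  under eq_bigr => t _ do rewrite shfm.
  rewrite big_const_seq count_predT size_iota iter_addr addr0 -mulr_natl.
  have -> : kap * (L%:R * cN) = L%:R / (M * (1 - eta)).
    by rewrite /kap; field; rewrite !lt0r_neq0 //; lra.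
  rewrite ler_pdivrMr ?mulr_gt0 ?subr_gt0 //.
  (* Widening costs ep / 4, and so does the rounding term 2 in [Lle]; together with [eta] this stays
     below [ep]. *)
  apply: (le_trans Lle).
  have -> : (ell + ep) * (M * (1 - eta)) = M * ((ell + ep) - eta * (ell + ep)).
    by ring.
  rewrite etaE.
  have M8 : 1 <= M * (ep / 8) by rewrite mulrC -ler_pdivrMr // mul1r.
  have : M * (ell + 2 * de) <= M * (ell + 2 * (ep / 8)) by rewrite ler_pM2l //; lra.
  lra.
Qed.

End TrigPolynomials.

(** * The outer measure and the mean *)

Section Outer.
Variables (R : realType) (n : nat).
Notation V := 'cV[int]_n.+1.
Notation X := (vecR R n.+1).
Implicit Types (E F : set X) (lo hi : X).

Lemma box_vol_ge0 lo hi : 0 <= box_vol lo hi.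
Proof. by apply: prodr_ge0 => i _; rewrite le_max lexx orbT. Qed.

Lemma leb_outer_cover E (lo hi : nat -> X) :
  E `<=` \bigcup_k box (lo k) (hi k) ->
  (leb_outer E <= \sum_(0 <= k <oo) (box_vol (lo k) (hi k))%:E)%E.
Proof. by move=> sub; apply: ereal_inf_lbound; exists lo, hi. Qed.

Lemma leb_outer_ge0 E : (0 <= leb_outer E)%E.
Proof.
apply: le_ereal_inf_tmp => _ [lo [hi [_ ->]]].
by apply: nneseries_ge0 => k _ _; rewrite lee_fin box_vol_ge0.
Qed.

Lemma le_leb_outer E F : E `<=` F -> (leb_outer E <= leb_outer F)%E.
Proof.
move=> EF; apply: le_ereal_inf => _ [lo [hi [sub ->]]].
by exists lo, hi; split => //; exact: subset_trans sub.
Qed.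

Lemma leb_outer_adherent E (e : R) : 0 < e -> leb_outer E \is a fin_num ->
  exists lo hi : nat -> X, E `<=` \bigcup_k box (lo k) (hi k) /\
    (\sum_(0 <= k <oo) (box_vol (lo k) (hi k))%:E < leb_outer E + e%:E)%E.
Proof.
by move=> e0 /(lb_ereal_inf_adherent e0)[_ [lo [hi [sub ->]]] lt]; exists lo, hi.
Qed.

Lemma leb_outer_box lo hi : (leb_outer (box lo hi) <= (box_vol lo hi)%:E)%E.
Proof.
(* The cover is padded with one-point boxes, of volume 0 because the dimension is positive. *)
pose lo' (k : nat) : X := if k is 0%N then lo else fun=> 0.
pose hi' (k : nat) : X := if k is 0%N then hi else fun=> 0.
have sub : box lo hi `<=` \bigcup_k box (lo' k) (hi' k).
  by move=> x xb; exists 0%N.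
apply: (le_trans (leb_outer_cover sub)).
rewrite (nneseries_split 0 1); last by move=> k _; rewrite lee_fin box_vol_ge0.
rewrite big_nat1 /= eseries0 ?adde0 // => k k1 _.
case: k k1 => // k _; rewrite /= /box_vol (bigD1 ord0) //= subrr.
by rewrite (_ : Num.max 0 0 = 0) ?mul0r //; apply/max_idPl.
Qed.

Lemma leb_outer0 : leb_outer (set0 : set X) = 0%E.
Proof.
apply/eqP; rewrite eq_le leb_outer_ge0 andbT.
have : (leb_outer (set0 : set X) <= leb_outer (@box R n.+1 (fun=> 0%R) (fun=> 0%R)))%E.
  exact: le_leb_outer.
move/le_trans; apply; apply: (le_trans (leb_outer_box _ _)).
rewrite lee_fin /box_vol (bigD1 ord0) //= subrr.
by rewrite (_ : Num.max 0 0 = 0) ?mul0r //; apply/max_idPl.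
Qed.

(** Covers of the [A k] with excess e / 2^(k+1) are merged along a bijection between naturals and
    pairs of naturals. *)
Lemma leb_outer_sigma_subadditive (A : nat -> set X) :
  (leb_outer (\bigcup_k A k) <= \sum_(0 <= k <oo) leb_outer (A k))%E.
Proof.
have [[i ioo]|] := pselect (exists i, leb_outer (A i) = +oo%E).
  rewrite (eseries_pinfty _ _ ioo) ?leey // => k _.
  by rewrite -ltNye (lt_le_trans _ (leb_outer_ge0 _)).
rewrite -forallNE => Aoo.
apply/lee_addgt0Pr => e e0.
rewrite (le_trans _ (epsilon_trick _ _ (ltW e0))) //; last first.
  by move=> k; exact: leb_outer_ge0.
pose P k (c : (nat -> X) * (nat -> X)) :=
  A k `<=` \bigcup_m box (c.1 m) (c.2 m) /\
  (\sum_(0 <= m <oo) (box_vol (c.1 m) (c.2 m))%:E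
     <= leb_outer (A k) + (e / (2 ^ k.+1)%:R)%:E)%E.
have [G PG] : {G : nat -> (nat -> X) * (nat -> X) & forall k, P k (G k)}.
  apply: (@choice _ _ P) => k.
  have e2 : 0 < e / (2 ^ k.+1)%:R by rewrite divr_gt0 // ltr0n expn_gt0.
  have fin : leb_outer (A k) \is a fin_num.
    by rewrite ge0_fin_numE ?leb_outer_ge0 // ltey; apply/eqP/Aoo.
  have [lo [hi [sub lt]]] := leb_outer_adherent e2 fin.
  by exists (lo, hi); split => //; exact: ltW.
pose a (p : nat * nat) : \bar R := (box_vol ((G p.1).1 p.2) ((G p.1).2 p.2))%:E.
have a0 p : (0 <= a p)%E by rewrite lee_fin box_vol_ge0.
have /card_esym/ppcard_eqP[f] := card_nat2.
apply: (@le_trans _ _ (\sum_(0 <= m <oo) a (f m))%E).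
  apply: (@leb_outer_cover _ (fun m => (G (f m).1).1 (f m).2) (fun m => (G (f m).1).2 (f m).2)).
  move=> x [k _ Akx]; have [/(_ x Akx)[m _ xm] _] := PG k.
  by exists (f^-1%FUN (k, m)) => //=; rewrite invK ?inE.
rewrite nneseries_esumT //.
have -> : (\esum_(i in [set: nat]) a (f i) = \esum_(p in [set: nat * nat]) a p)%E.
  apply/esym; apply: reindex_esum; exact: bij.
have -> : [set: nat * nat] = [set: nat] `*`` (fun=> [set: nat]) by apply/seteqP; split.
have -> : (\esum_(p in [set: nat] `*`` (fun=> [set: nat])) a p =
   \esum_(i in [set: nat]) \esum_(j in [set: nat]) a (i, j))%E.
  by rewrite esum_esum //; apply: eq_esum => -[].
rewrite -nneseries_esumT; last by move=> k; exact: esum_ge0.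
apply: lee_nneseries => [k _ _|k _]; first exact: esum_ge0.
rewrite -nneseries_esumT //.
by case: (PG k).
Qed.

Lemma leb_outerU E F : (leb_outer (E `|` F) <= leb_outer E + leb_outer F)%E.
Proof.
rewrite -bigcup2E; apply: (le_trans (leb_outer_sigma_subadditive _)).
rewrite (nneseries_split 0 2); last by move=> k _; exact: leb_outer_ge0.
rewrite eseries0 ?adde0; last first.
  by case=> [|[|k]] // _ _; rewrite /bigcup2 /= leb_outer0.
by rewrite add0n big_ltn // big_nat1.
Qed.

Lemma leb_outer_finite_cover (I : eqType) (r : seq I) (lo hi : I -> X) E :
  (forall x, E x -> exists2 i, i \in r & box (lo i) (hi i) x) ->
  (leb_outer E <= (\sum_(i <- r) box_vol (lo i) (hi i))%:E)%E.
Proof.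
elim: r E => [|i r IH] E cov.
  apply: (@le_trans _ _ (leb_outer (set0 : set X))); last by rewrite leb_outer0 big_nil.
  apply: le_leb_outer => x /cov[i].
  by rewrite in_nil.
rewrite big_cons EFinD.
apply: (@le_trans _ _ (leb_outer (box (lo i) (hi i)) + leb_outer (E `\` box (lo i) (hi i)))%E).
  apply: le_trans (leb_outerU _ _); apply: le_leb_outer => x Ex.
  by have [xb|xb] := pselect (box (lo i) (hi i) x); [left | right].
apply: leeD; first exact: leb_outer_box.
apply: IH => x [/cov[j]]; rewrite inE => /orP[/eqP ->|jr xj _]; last by exists j.
by [].
Qed.

Lemma leb_outer_null_bigcup (T : countType) (A : T -> set X) E :
  (forall t, leb_outer (A t) = 0%E) -> E `<=` \bigcup_t A t -> leb_outer E = 0%E.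
Proof.
move=> A0 sub; apply/eqP; rewrite eq_le leb_outer_ge0 andbT.
pose B k := if unpickle k is Some t then A t else set0.
have EB : E `<=` \bigcup_k B k.
  by move=> x /sub[t _ xt]; exists (pickle t) => //; rewrite /B pickleK.
apply: (le_trans (le_leb_outer EB)); apply: (le_trans (leb_outer_sigma_subadditive _)).
by rewrite eseries0 // => k _ _; rewrite /B; case: unpickle => [t|]; rewrite ?leb_outer0.
Qed.

Lemma leb_outer_unit_cube : (leb_outer (@unit_cube R n.+1) <= 1)%E.
Proof.
apply: (@le_trans _ _ (leb_outer (box (fun=> 0 : R) (fun=> 1 : R) : set X))).
  by apply: le_leb_outer => x xQ i; case/andP: (xQ i) => -> /ltW ->.
apply: (le_trans (leb_outer_box _ _)); rewrite lee_fin /box_vol big1 // => i _.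
by rewrite subr0; apply/max_idPl.
Qed.

(** * Linear forms, grid averages and the bound of the outer measure by the mean *)

Definition lin (x : X) (k : V) : R := \sum_i x i * (k i 0)%:~R.

Lemma linD x : {morph lin x : a b / a + b}.
Proof.
move=> a b; rewrite /lin -big_split; apply: eq_bigr => i _ /=.
by rewrite mxE intrD mulrDr.
Qed.

Lemma lin0 x : lin x 0 = 0.
Proof. by rewrite /lin big1 // => i _; rewrite mxE mulr0. Qed.

(** Points are rows and frequencies columns, so the pairing transfers [rho g] to a left
    multiplication; trigonometric polynomials are thereby stable under the action. *)
Lemma lin_rho (g : 'M[int]_2) x k : lin (rho g x) k = lin x (rho_mx n g *m k).
Proof.
rewrite /lin /rho; under eq_bigr => j _ do rewrite mulr_suml.
rewrite exchange_big; apply: eq_bigr => i _ /=.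
rewrite mxE rmorph_sum mulr_sumr; apply: eq_bigr => j _ /=.
by rewrite rho_coefE intrM mulrA.
Qed.

Lemma tev_int_vec x y (s : seq (R * V * R)) : int_vec (fun i => x i - y i) ->
  tev (lin x) s = tev (lin y) s.
Proof.
move=> xy; apply: eq_bigr => t _; congr (_ * _).
have -> : lin x t.1.2 + t.2 = (lin y t.1.2 + t.2) + (lin x t.1.2 - lin y t.1.2) by ring.
apply: csDint; rewrite /lin -sumrB rpred_sum // => i _.
by rewrite -mulrBl rpredM // intr_int.
Qed.

Lemma tev_lipschitz (s : seq (R * V * R)) : exists2 L : R, 0 <= L &
  forall x y d, (forall i, `|x i - y i| <= d) ->
    `|tev (lin x) s - tev (lin y) s| <= L * d.
Proof.
elim: s => [|t s [L L0 HL]].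
  by exists 0 => // x y d _; rewrite /tev !big_nil subrr normr0 mul0r.
pose c := \sum_i `|(t.1.2 i 0)%:~R : R|.
have pi0 : 0 <= 2 * pi :> R by rewrite mulr_ge0 // pi_ge0.
exists (`|t.1.1| * (2 * pi * c) + L) => [|x y d xy].
  by rewrite addr_ge0 // !mulr_ge0 ?pi_ge0 // sumr_ge0.
rewrite /tev !big_cons -!/(tev _ _).
have -> : forall a b c' d' : R, a + b - (c' + d') = (a - c') + (b - d') by move=> *; ring.
apply: (le_trans (ler_normD _ _)); rewrite mulrDl lerD ?HL //.
rewrite -mulrBr normrM -[leRHS]mulrA ler_wpM2l //.
apply: (le_trans (cs_lipschitz _ _)); rewrite -[leRHS]mulrA ler_wpM2l //.
have -> : lin x t.1.2 + t.2 - (lin y t.1.2 + t.2) = lin x t.1.2 - lin y t.1.2 by ring.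
rewrite /lin -sumrB; apply: (le_trans (ler_norm_sum _ _ _)).
rewrite /c mulr_suml; apply: ler_sum => i _.
by rewrite -mulrBl normrM mulrC ler_wpM2l.
Qed.

Definition corner (M : nat) (j : {ffun 'I_n.+1 -> 'I_M.+1}) : X :=
  fun i => (j i : nat)%:R / M.+1%:R.

(** A nonzero frequency has a nonzero coordinate [p], at most [M] in size; the cyclic shift of the
    grid in direction [p] then moves its phase by a non-integer. *)
Lemma grid_average (s : seq (R * V * R)) M :
  (forall t i, t \in s -> (`|t.1.2 i 0%R| <= M)%N) ->
  \sum_j tev (lin (@corner M j)) s = M.+1%:R ^+ n.+1 * tmean s.
Proof.
move=> sM.
transitivity (#|{ffun 'I_n.+1 -> 'I_M.+1}|%:R * tmean s); last first.
  by rewrite card_ffun !card_ord natrX.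
rewrite -(@sum_tev _ _ _ (fun=> 0) (fun j => lin (@corner M j))) //.
- by apply: eq_bigr => j _; apply: eq_bigr => t _; rewrite add0r.
- by move=> j; exact: lin0.
move=> t ts t0.
have [p tp] : exists p, t.1.2 p 0 != 0.
  apply/existsP; apply: contraNT t0; rewrite negb_exists => /forallP H.
  apply/eqP/colP => i; apply/eqP; rewrite mxE.
  by have := H i; rewrite negbK.
exists (fun j : {ffun 'I_n.+1 -> 'I_M.+1} => [ffun i => if i == p then ordS (j i) else j i]).
exists ((t.1.2 p 0)%:~R / M.+1%:R); split.
- move=> j j' /ffunP H; apply/ffunP => i; have := H i; rewrite !ffunE.
  by case: eqP => // _; exact: (can_inj (@ordSK _)).
- by rewrite cs_frac_neq1 // ltnS sM.
move=> j; have [z zE] := ordS_shift R (t.1.2 p 0) (j p).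
exists z; rewrite /lin (bigD1 p) //= [in RHS](bigD1 p) //=.
rewrite /corner ffunE eqxx.
have -> : \sum_(i < n.+1 | i != p)
      (([ffun i => if i == p then ordS (j i) else j i] i : nat)%:R / M.+1%:R)
        * (t.1.2 i 0)%:~R = \sum_(i < n.+1 | i != p) ((j i : nat)%:R / M.+1%:R) * (t.1.2 i 0)%:~R :> R.
  by apply: eq_bigr => i /negbTE ip; rewrite ffunE ip.
have C (u : nat) : u%:R / M.+1%:R * (t.1.2 p 0)%:~R = (t.1.2 p 0)%:~R * u%:R / M.+1%:R :> R.
  by rewrite mulrC mulrA.
by rewrite !C zE; ring.
Qed.

Lemma freq_bound (s : seq (R * V * R)) : exists M, forall t i, t \in s ->
  (`|t.1.2 i 0%R| <= M)%N.
Proof.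
elim: s => [|t s [M HM]]; first by exists 0%N.
exists (maxn M (\max_i `|t.1.2 i 0%R|%N)) => u i; rewrite inE leq_max.
move=> /orP[/eqP ->|/HM ->] //.
by apply/orP; right; exact: (leq_bigmax i).
Qed.

Lemma tmean_ge0 (s : seq (R * V * R)) : (forall x, 0 <= tev (lin x) s) ->
  0 <= tmean s.
Proof.
move=> s0; have [M HM] := freq_bound s.
have := grid_average HM.
have : 0 <= \sum_j tev (lin (@corner M j)) s by apply: sumr_ge0.
move=> /[swap] ->; rewrite pmulr_rge0 // exprn_gt0 // ltr0n.
Qed.

(* Cover [E] by the cells of a fine grid that meet [E]: at their corners [s] is
   almost at least 1, and the grid average of [s] is exactly its mean. *)
Lemma leb_outer_le_tmean (s : seq (R * V * R)) E : E `<=` @unit_cube R n.+1 ->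
  (forall x, 0 <= tev (lin x) s) -> (forall x, E x -> 1 <= tev (lin x) s) ->
  (leb_outer E <= (tmean s)%:E)%E.
Proof.
move=> EQ s0 s1; apply/lee_addgt0Pr => e e0.
have m0 := tmean_ge0 s0; set m := tmean s in m0 *.
have [L L0 HL] := tev_lipschitz s.
have me0 : 0 < m + e by rewrite ltr_wpDl.
(* With this [d], (m + e) (1 - d) = m + e / 2, so dividing [m] by 1 - d costs at most [e]. *)
pose d := e / (2 * (m + e)).
have d0 : 0 < d by rewrite divr_gt0 // mulr_gt0.
have dE : d * (m + e) = e / 2 by rewrite /d; field; rewrite lt0r_neq0.
have d1 : d < 1 by rewrite /d ltr_pdivrMr ?mulr_gt0 // mul1r; lra.
have [M1 HM1] := freq_bound s.
(* The grid is finer than all frequencies, and so fine that [s] differs by at most [d] between a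
   point and the corner of its cell. *)
pose M := maxn M1 (Num.truncn (L / d)).
have HM t i : t \in s -> (`|t.1.2 i 0%R| <= M)%N.
  by move=> /(HM1 _ i) h; rewrite (leq_trans h) // leq_maxl.
have M0 : 0 < M.+1%:R :> R by rewrite ltr0n.
have LM : L * M.+1%:R^-1 <= d.
  rewrite ler_pdivrMr // mulrC -ler_pdivrMr //.
  apply: ltW; apply: (lt_le_trans (truncnS_gt _)).
  by rewrite ler_nat ltnS leq_maxr.
pose J := {ffun 'I_n.+1 -> 'I_M.+1}.
pose top (j : J) : X := fun i => corner j i + M.+1%:R^-1.
pose H := [seq j <- enum J | 1 - d <= tev (lin (corner j)) s].
have cov x : E x -> exists2 j, j \in H & box (corner j) (top j) x.
  move=> Ex; have xQ := EQ x Ex.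
  pose j : J := [ffun i => inord (Num.truncn (x i * M.+1%:R))].
  have jE i : (j i : nat) = Num.truncn (x i * M.+1%:R).
    have /andP[xi0 xi1] := xQ i.
    rewrite ffunE inordK // -(ltr_nat R).
    apply: (@le_lt_trans _ _ (x i * M.+1%:R)); last by rewrite gtr_pMl.
    by rewrite truncn_le mulr_ge0.
  have jx i : corner j i <= x i <= top j i.
    have /andP[xi0 xi1] := xQ i.
    rewrite /top /corner jE; apply/andP; split.
      by rewrite ler_pdivrMr // truncn_le // mulr_ge0.
    rewrite -[X in _ + X]mul1r -mulrDl ler_pdivlMr // natr1.
    by apply: ltW; exact: truncnS_gt.
  exists j; last exact: jx.
  rewrite mem_filter mem_enum andbT.
  have /(HL x (corner j)) : forall i, `|x i - corner j i| <= M.+1%:R^-1.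
    move=> i; have /andP[h1 h2] := jx i.
    by rewrite ger0_norm ?subr_ge0 // lerBlDl.
  move=> /le_trans/(_ LM); have := s1 x Ex; rewrite ler_norml.
  by move=> h1 /andP[_ h2]; lra.
apply: (le_trans (leb_outer_finite_cover cov)); rewrite lee_fin.
have vol j : box_vol (corner j) (top j) = M.+1%:R^-1 ^+ n.+1.
  rewrite /box_vol; under eq_bigr => i _.
    rewrite /top addrAC subrr add0r (_ : Num.max _ _ = M.+1%:R^-1); last first.
      by apply/max_idPl; rewrite invr_ge0 ltW.
  over.
  by rewrite prodr_const card_ord.
under eq_bigr => j _ do rewrite vol.
pose v : R := M.+1%:R^-1 ^+ n.+1.
have v0 : 0 <= v by rewrite exprn_ge0 // invr_ge0 ltW.
(* Markov's inequality on the grid: corners in [H] contribute at least 1 - d each, and the others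
   are nonnegative. *)
have : \sum_(j <- H) v * (1 - d) <= v * (\sum_j tev (lin (@corner M j)) s).
  rewrite mulr_sumr big_filter.
  rewrite [leRHS](bigID (fun j => 1 - d <= tev (lin (corner j)) s)) /=.
  rewrite -[leLHS]addr0 lerD ?sumr_ge0 //; last by move=> j _; rewrite mulr_ge0.
  rewrite big_enum_cond /=; apply: ler_sum => j hj.
  by rewrite ler_wpM2l.
rewrite grid_average // mulrA -exprMn mulVf ?lt0r_neq0 // expr1n mul1r.
rewrite -mulr_suml -ler_pdivlMr ?subr_gt0 // => /le_trans; apply.
rewrite ler_pdivrMr ?subr_gt0 // mulrBr mulr1 mulrC dE -/m; lra.
Qed.

End Outer.

(** * Majorants of boxes, ergodicity and freeness *)

Section Majorants.
Variables (R : realType) (n : nat).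
Notation V := 'cV[int]_n.+1.
Notation X := (vecR R n.+1).
Implicit Types (E F : set X) (lo hi : X).

Lemma linZ (x : X) (z : int) (l : V) : lin x (z *: l) = z%:~R * lin x l.
Proof.
rewrite /lin mulr_sumr; apply: eq_bigr => i _.
by rewrite mxE intrM mulrCA.
Qed.

Lemma lin_delta (x : X) (p : 'I_n.+1) : lin x (delta_mx p 0) = x p.
Proof.
rewrite /lin (bigD1 p) //= big1 ?addr0; first by rewrite mxE !eqxx mulr1.
by move=> i /negbTE ip; rewrite mxE ip mulr0.
Qed.

(** The interval majorant is pulled back along [l]; as [l] is nonzero, no nonzero frequency becomes
    0 and the mean is kept. The last clause serves to exclude resonances in [box_majorant]. *)
Lemma strip_majorant (l : V) (al be ep : R) : l != 0 -> 0 < ep ->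
  exists s : seq (R * V * R),
  [/\ forall x : X, 0 <= tev (lin x) s,
      forall (x : X) (z : int), al <= lin x l - z%:~R <= be -> 1 <= tev (lin x) s,
      tmean s <= Num.max (be - al) 0 + ep &
      forall t, t \in s -> exists z : int, t.1.2 = z *: l].
Proof.
move=> l0 ep0; have [s [s0 s1 sm]] := @interval_majorant R al be ep ep0.
pose f (z : int) : V := z *: l.
have sE (x : X) : tev (lin x) (tmap f s) = tev (lin1 (lin x l)) s.
  by rewrite tev_map; apply: eq_bigr => t _; rewrite /= linZ.
exists (tmap f s); split.
- by move=> x; rewrite sE.
- by move=> x z xz; rewrite sE; exact: s1 xz.
- rewrite tmean_map // => z; apply/eqP/eqP => [zl|->]; last exact: scale0r.
  apply/eqP; apply: contraT => z0; move/eqP: l0 => []; apply/colP => i.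
  move/colP: zl => /(_ i); rewrite !mxE => /eqP.
  by rewrite mulf_eq0 (negbTE z0) => /eqP.
- by move=> t /mapP[u _ ->]; exists u.1.2.
Qed.

(** Saturated under Z^n because [rho g x] may leave the unit cube while covering boxes do not follow
    it; majorants are periodic and control all translates. *)
Definition torus_box lo hi : set X :=
  [set x | exists2 y : X, int_vec (fun i => x i - y i) & box lo hi y].

Lemma box_torus_box lo hi (x : X) : box lo hi x -> torus_box lo hi x.
Proof. by move=> xb; exists x => // i; rewrite subrr. Qed.

(** A product of strip majorants, one per coordinate: factors in distinct coordinates do not
    resonate, so the means multiply. *)
Lemma box_majorant lo hi (ep : R) : 0 < ep ->
  exists s : seq (R * V * R),
  [/\ forall x : X, 0 <= tev (lin x) s,
      forall x : X, torus_box lo hi x -> 1 <= tev (lin x) s &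
      tmean s <= box_vol lo hi + ep].
Proof.
move=> ep0.
pose v (i : 'I_n.+1) := Num.max (hi i - lo i) 0.
have v0 i : 0 <= v i by rewrite le_max lexx orbT.
have partial p (pn : (p <= n.+1)%N) e : 0 < e -> exists s : seq (R * V * R),
  [/\ forall x : X, 0 <= tev (lin x) s,
      forall x : X, (forall i : 'I_n.+1, (i < p)%N -> lo i <= x i <= hi i) ->
        1 <= tev (lin x) s,
      tmean s <= \prod_(i < n.+1 | (i < p)%N) v i + e &
      forall t (i : 'I_n.+1), t \in s -> (p <= i)%N -> t.1.2 i 0 = 0].
  elim: p pn e => [|p IH] pn e e0.
    exists [:: (1, 0, 0)]; split.
    - by move=> x; rewrite /tev big_seq1 /= lin0 addr0 cs0 mulr1.
    - by move=> x _; rewrite /tev big_seq1 /= lin0 addr0 cs0 mulr1.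
    - by rewrite /tmean big_mkcond big_seq1 /= eqxx cs0 big_pred0_eq mulr1 lerDl ltW.
    - by move=> t i; rewrite inE => /eqP -> _; rewrite mxE.
  pose q : 'I_n.+1 := Ordinal pn.
  pose W := \prod_(i < n.+1 | (i < p)%N) v i.
  have W0 : 0 <= W by apply: prodr_ge0.
  have D0 : 0 < W + v q + 1 by rewrite ltr_wpDl // addr_ge0.
  (* Chosen so that (W + d) (v q + d) <= W v q + d (W + v q + 1) <= W v q + e, using d^2 <= d. *)
  pose d := Num.min 1 (e / (W + v q + 1)).
  have d0 : 0 < d by rewrite lt_min ltr01 divr_gt0.
  have d1 : d <= 1 by rewrite ge_min lexx.
  have de : d * (W + v q + 1) <= e by rewrite -ler_pdivlMr // ge_min lexx orbT.
  have coordZ (z : int) (i : 'I_n.+1) : (z *: delta_mx q 0 : V) i 0 = z *+ (i == q).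
    by rewrite !mxE eqxx andbT mulr_natr.
  have [s [s0 s1 sm sf]] := IH (ltnW pn) d d0.
  have q0 : delta_mx q 0 != 0 :> V.
    by apply/eqP => /matrixP/(_ q 0); rewrite !mxE !eqxx.
  have [s' [s'0 s'1 s'm s'f]] := @strip_majorant (delta_mx q 0) (lo q) (hi q) d q0 d0.
  have tevE (x : X) : tev (lin x) (tmul s s') = tev (lin x) s * tev (lin x) s'.
    by apply: tev_mul; exact: linD.
  exists (tmul s s'); split.
  - by move=> x; rewrite tevE mulr_ge0.
  - move=> x xb; rewrite tevE; apply: mulr_ege1.
      by apply: s1 => i ip; apply: xb; exact: ltnW.
    by apply: (s'1 x 0); rewrite lin_delta subr0; exact: xb.
  - have nr : non_resonant s s'.
      move=> t u ts us H; have [z uE] := s'f u us.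
      have tq : t.1.2 q 0 = 0 by apply: sf.
      have z0 : z = 0.
        case: H => /(congr1 (fun M : V => M q 0)).
          by rewrite mxE tq add0r uE coordZ eqxx mxE.
        rewrite mxE tq add0r mxE uE coordZ eqxx mxE.
        by move/eqP; rewrite oppr_eq0 => /eqP.
      have u0 : u.1.2 = 0 by rewrite uE z0 scale0r.
      by move: H; rewrite u0 addr0 subr0; case=> ->.
    rewrite tmean_mul //.
    have -> : \prod_(i < n.+1 | (i < p.+1)%N) v i = v q * W.
      rewrite (bigD1 q) //=; congr (_ * _); apply: eq_bigl => i.
      by rewrite -val_eqE /= ltnS [RHS]ltn_neqAle andbC.
    apply: (@le_trans _ _ ((W + d) * (v q + d))).
      by apply: ler_pM => //; exact: tmean_ge0.
    have : d * d <= d by rewrite ler_piMl // ltW.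
    by move: de; lra.
  - move=> t i; rewrite mem_cat => H pi.
    have iq : (i == q) = false by apply/negbTE; rewrite -val_eqE /= gtn_eqF.
    case/orP: H => /allpairsP[[a b]] [/= /sf ha /s'f[z zE] ->] /=.
      by rewrite mxE (ha i (ltnW pi)) zE coordZ iq addr0.
    by rewrite mxE (ha i (ltnW pi)) mxE zE coordZ iq oppr0 addr0.
have [s [s0 s1 sm _]] := partial n.+1 (leqnn _) ep ep0.
exists s; split => //.
- by move=> x [y xy yb]; rewrite (tev_int_vec s xy); apply: s1 => i _; exact: yb.
- apply: (le_trans sm); rewrite lerD2r le_eqVlt; apply/orP; left; apply/eqP.
  by apply: eq_bigl => i; rewrite ltn_ord.
Qed.

Lemma tmean_rho (g : 'M[int]_2) (s : seq (R * V * R)) : SL2Z g ->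
  tmean (tmap (mulmx (rho_mx n g)) s) = tmean s.
Proof.
move=> g1; apply: tmean_map => l; apply/eqP/eqP => [|->]; last exact: mulmx0.
exact: rho_mx_inj.
Qed.

Lemma tev_rho (g : 'M[int]_2) (s : seq (R * V * R)) (x : X) :
  tev (lin x) (tmap (mulmx (rho_mx n g)) s) = tev (lin (rho g x)) s.
Proof. by rewrite tev_map; apply: eq_bigr => t _; rewrite lin_rho. Qed.

(** The part of measure invariance that is needed: composing a majorant of the box with [rho g] does
    not change its mean. *)
Lemma leb_outer_rho_preimage (g : 'M[int]_2) lo hi : SL2Z g ->
  (leb_outer (@unit_cube R n.+1 `&` [set x | torus_box lo hi (rho g x)])
     <= (box_vol lo hi)%:E)%E.
Proof.
move=> g1; apply/lee_addgt0Pr => e e0.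
have [s [s0 s1 sm]] := @box_majorant lo hi e e0.
rewrite -EFinD; apply: (@le_trans _ _ (tmean s)%:E); last by rewrite lee_fin.
rewrite -(tmean_rho s g1); apply: leb_outer_le_tmean.
- by move=> x [].
- by move=> x; rewrite tev_rho.
- by move=> x [_ /s1]; rewrite tev_rho.
Qed.

Lemma boxes_majorant (lo hi : nat -> X) N (ep : R) : 0 < ep ->
  exists s : seq (R * V * R),
  [/\ forall x : X, 0 <= tev (lin x) s,
      forall (x : X) k, (k < N)%N -> torus_box (lo k) (hi k) x -> 1 <= tev (lin x) s &
      tmean s <= \sum_(0 <= k < N) box_vol (lo k) (hi k) + ep].
Proof.
elim: N ep => [|N IH] ep ep0.
  exists [::]; split => [x|x k //|]; rewrite /tev /tmean !big_nil //.
  by rewrite add0r ltW.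
have ep2 : 0 < ep / 2 by rewrite divr_gt0.
have [s [s0 s1 sm]] := IH _ ep2.
have [s' [s'0 s'1 s'm]] := @box_majorant (lo N) (hi N) _ ep2.
exists (s ++ s'); split.
- by move=> x; rewrite tev_cat addr_ge0.
- move=> x k; rewrite ltnS leq_eqVlt tev_cat => /orP[/eqP ->|kN] xk.
    by rewrite ler_wpDl // s'1.
  by rewrite ler_wpDr // (s1 x k).
- rewrite tmean_cat big_nat_recr //=; lra.
Qed.

Lemma int_vec_frac (x : X) : exists2 y : X, unit_cube y & int_vec (fun i => x i - y i).
Proof.
exists (fun i => x i - (Num.floor (x i))%:~R) => i.
  rewrite subr_ge0 floor_le_tmp /= ltrBlDr addrC.
  by rewrite -[X in _ + X]/(1%:~R) -intrD; exact: floorD1_gt.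
by rewrite opprB addrC subrK intr_int.
Qed.

Lemma dispersing_quadratic (S : set 'M[int]_2) (A : set X) (r e : R) :
  S `<=` SL2Z -> dispersing n S -> torus_set A ->
  (forall g, S g -> forall x, A (rho g x) <-> A x) ->
  leb_outer (A `&` @unit_cube R n.+1) = r%:E -> 0 < e ->
  r <= (r + 2 * e) ^+ 2 + 2 * e.
Proof.
move=> SSL disp tA invA rE e0.
have [||lo [hi [sub lt]]] := @leb_outer_adherent R n (A `&` @unit_cube R n.+1) e.
- exact: e0.
- by rewrite rE.
pose vol k := box_vol (lo k) (hi k).
have vol0 k : (0 <= (vol k)%:E)%E by rewrite lee_fin box_vol_ge0.
rewrite rE -EFinD in lt.
have [N tailN] : exists N, (\sum_(N <= k <oo) (vol k)%:E <= e%:E)%E.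
  have fin : (\sum_(0 <= k <oo) (vol k)%:E < +oo)%E by exact: lt_trans lt (ltry _).
  have := nneseries_tail_cvg fin (fun k _ => vol0 k).
  move=> /fine_cvgP[fN /cvgrPdist_lt/(_ e e0) H].
  near \oo => N; exists N.
  have : (\sum_(N <= k <oo) (vol k)%:E)%E \is a fin_num by near: N.
  move=> /fineK <-; rewrite lee_fin.
  have : `|0 - fine (\sum_(N <= k <oo) (vol k)%:E)%E| < e by near: N.
  by rewrite sub0r normrN => /ltW; apply: le_trans; exact: ler_norm.
have headN : \sum_(0 <= k < N) vol k <= r + e.
  rewrite -lee_fin -sumEFin; apply: le_trans (ltW lt).
  exact: nneseries_lim_ge.
have [f [f0 f1 fm]] := @boxes_majorant lo hi N e e0.
pose fr := [seq t.1.2 | t <- f].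
(* [g] is chosen after [f]. Avoiding the frequencies of [f] and their opposites excludes resonance
   both in differences and in sums. *)
have [g Sg Hg] := disp (fr ++ [seq - k | k <- fr]) fr.
have g1 := SSL _ Sg.
pose fg := tmap (mulmx (rho_mx n g)) f.
have tevE (x : X) : tev (lin x) (tmul f fg) = tev (lin x) f * tev (lin (rho g x)) f.
  by rewrite tev_mul ?tev_rho //; exact: linD.
have nr : non_resonant f fg.
  move=> t _ tf /mapP[u uf ->] /= H.
  have tK : t.1.2 \in fr by apply: map_f.
  have uK : u.1.2 \in fr by apply: map_f.
  have u0 : u.1.2 = 0.
    apply/eqP; apply: contraT => u0; case: H => /eqP.
      rewrite addrC addr_eq0 => H; move: (Hg (- t.1.2) u.1.2).
      by rewrite mem_cat map_f ?orbT // => /(_ isT uK u0); rewrite H.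
    rewrite subr_eq0 eq_sym => H; move: (Hg t.1.2 u.1.2).
    by rewrite mem_cat tK => /(_ isT uK u0); rewrite H.
  by move: H; rewrite u0 mulmx0 addr0 subr0; case=> ->.
have fmean : tmean f <= r + 2 * e by move: fm headN; rewrite /vol; lra.
(* Let [y] be [rho g x] reduced modulo Z^n. If boxes of index below [N] contain [x] and [y], then
   [x] is in [E1]; a tail box around [x] puts it in [E2], one around [y] in [E3]. *)
pose E1 : set X := @unit_cube R n.+1 `&`
  [set x | 1 <= tev (lin x) f /\ 1 <= tev (lin (rho g x)) f].
pose E2 : set X := \bigcup_k box (lo (k + N)%N) (hi (k + N)%N).
pose E3 : set X := \bigcup_k (@unit_cube R n.+1 `&`
  [set x | torus_box (lo (k + N)%N) (hi (k + N)%N) (rho g x)]).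
have tail' : (\sum_(0 <= k <oo) (vol (k + N)%N)%:E <= e%:E)%E.
  by rewrite (nneseries_addn (f := fun k => (vol k)%:E)).
have L1 : (leb_outer E1 <= ((r + 2 * e) ^+ 2)%:E)%E.
  apply: (@le_trans _ _ (tmean (tmul f fg))%:E).
    apply: leb_outer_le_tmean => [x []//|x|x [_ [h1 h2]]].
      by rewrite tevE mulr_ge0.
    by rewrite tevE mulr_ege1.
  have fm0 : 0 <= tmean f by exact: tmean_ge0.
  by rewrite lee_fin tmean_mul // tmean_rho // expr2 ler_pM.
have L2 : (leb_outer E2 <= e%:E)%E.
  apply: le_trans tail'; exact: leb_outer_cover.
have L3 : (leb_outer E3 <= e%:E)%E.
  apply: le_trans tail'; apply: (le_trans (leb_outer_sigma_subadditive _)).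
  apply: lee_nneseries => [k _ _|k _]; first exact: leb_outer_ge0.
  exact: leb_outer_rho_preimage.
have cov : A `&` @unit_cube R n.+1 `<=` E1 `|` (E2 `|` E3).
  move=> x [Ax Qx]; have [k _ xk] := sub x (conj Ax Qx).
  have [y Qy xy] := int_vec_frac (rho g x).
  have Ay : A y by apply: (tA _ _ xy); apply/(invA g Sg).
  have [k' _ yk'] := sub y (conj Ay Qy).
  have xk' : torus_box (lo k') (hi k') (rho g x) by exists y.
  have [kN|Nk] := ltnP k N; last first.
    by right; left; exists (k - N)%N => //; rewrite subnK.
  have [k'N|Nk'] := ltnP k' N; last first.
    by right; right; exists (k' - N)%N => //; split => //=; rewrite subnK.
  left; split => //; split; first by apply: (f1 x k) => //; exact: box_torus_box.
  exact: (f1 (rho g x) k').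
have := le_leb_outer cov; rewrite rE => /le_trans/(_ (leb_outerU _ _)).
move=> /le_trans/(_ (leeD L1 (le_trans (leb_outerU _ _) (leeD L2 L3)))).
by rewrite -!EFinD lee_fin; lra.
Unshelve. all: by end_near.
Qed.

Lemma ergodic_dispersing (S : set 'M[int]_2) :
  S `<=` SL2Z -> dispersing n S -> ergodic_on R n.+1 S.
Proof.
move=> SSL disp A tA mA invA.
set a := leb_outer (A `&` @unit_cube R n.+1).
have a0 : (0 <= a)%E by exact: leb_outer_ge0.
have a1 : (a <= 1)%E.
  by apply: le_trans (leb_outer_unit_cube R n); apply: le_leb_outer => x [].
have [r aE] : exists r, a = r%:E.
  by case: a a0 a1 => [r _ _|//|//]; exists r.
have r0 : 0 <= r by move: a0; rewrite aE lee_fin.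
have r1 : r <= 1 by move: a1; rewrite aE lee_fin.
have quad e : 0 < e -> r <= (r + 2 * e) ^+ 2 + 2 * e.
  exact: (dispersing_quadratic SSL disp tA invA aE).
have [rz|rpos] := eqVneq r 0; first by left; rewrite /torus_null -/a aE rz.
right.
have {}r1 : r = 1.
  apply/eqP; rewrite eq_le r1 /= leNgt; apply/negP => rlt.
  have p0 : 0 < r * (1 - r) by rewrite mulr_gt0 ?subr_gt0 // lt0r rpos.
  (* As r and e are at most 1, the inequality gives r <= r^2 + 10 e, that is r (1 - r) <= r (1 - r)
     / 2. *)
  pose e := r * (1 - r) / 20.
  have e0 : 0 < e by rewrite divr_gt0.
  have e1 : e <= 1 by rewrite /e; nra.
  have := quad e e0.
  have eE : 20 * e = r * (1 - r) by rewrite /e; field.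
  have re : r * e <= e by rewrite ler_piMl // ltW.
  have ee : e * e <= e by rewrite ler_piMl // ltW.
  by clearbody e; move: p0 e0 eE re ee; clear; lra.
(* Measurability is tested on the unit cube: its outer measure is at most 1, which leaves 0 for the
   complement of [A]. *)
have := mA (@unit_cube R n.+1).
rewrite setIC -/a aE r1 => QE.
rewrite /torus_null setIC.
have := leb_outer_unit_cube R n; rewrite QE.
have := leb_outer_ge0 (@unit_cube R n.+1 `&` ~` A).
case: (leb_outer _) => [x| |] //; rewrite -EFinD !lee_fin => x0 x1.
by congr EFin; lra.
Qed.

Lemma essentially_free_rho : (0 < n)%N -> essentially_free R n.+1.
Proof.
move=> n0; rewrite /essentially_free /torus_null.
pose B (g : 'M[int]_2) : set X := [set x | [/\ SL2Z g, nontrivial_in_Gn n.+1 g,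
  int_vec (fun i => rho g x i - x i) & unit_cube x]].
apply: (@leb_outer_null_bigcup _ _ _ B); last first.
  by move=> x [[g [g1 [gn gx]]] Qx]; exists g.
move=> g; apply/eqP; rewrite eq_le leb_outer_ge0 andbT.
have [[g1 gn]|ng] := pselect (SL2Z g /\ nontrivial_in_Gn n.+1 g); last first.
  rewrite -(leb_outer0 R n); apply: le_leb_outer => x [h1 h2 _ _].
  by apply: ng.
(* A nonzero column of [rho_mx n g - 1] is the integer vector [l]: on fixed points its linear form
   takes integer values. *)
have [j lj] : exists j, col j (rho_mx n g - 1%:M) != 0.
  apply/existsP; apply: contraT; rewrite negb_exists => /forallP H; exfalso.
  apply: (rho_mx_faithful n0 g1 gn); apply/eqP; rewrite -subr_eq0.
  apply/eqP/matrixP => i j; have := H j; rewrite negbK => /eqP/colP/(_ i).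
  by rewrite !mxE.
have linE (x : X) : lin x (col j (rho_mx n g - 1%:M)) = rho g x j - x j.
  rewrite /lin; under eq_bigr => i _.
    rewrite mxE [X in X%:~R]mxE [X in (_ + X)%:~R]mxE [X in (_ - X)%:~R]mxE.
    rewrite intrB mulrBr; over.
  rewrite sumrB; congr (_ - _).
    by apply: eq_bigr => i _; rewrite rho_coefE.
  rewrite (bigD1 j) //= eqxx mulr1 big1 ?addr0 // => i /negbTE ->.
  by rewrite mulr0.
apply/lee_addgt0Pr => e e0; rewrite add0e.
(* The strip has width 0, so its majorant has mean at most [e]. *)
have [s [s0 s1 sm _]] := @strip_majorant _ 0 0 e lj e0.
apply: (@le_trans _ _ (tmean s)%:E).
  apply: leb_outer_le_tmean => [x []//|//|x [_ _ gx _]].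
  have /intrP[z zE] := gx j.
  by apply: (s1 x z); rewrite linE zE subrr lexx.
by rewrite lee_fin (le_trans sm) // subrr (_ : Num.max 0 0 = 0) ?add0r //; apply/max_idPl.
Qed.

End Majorants.

Theorem theorem1p1 (R : realType) (n : nat) (hn : (2 <= n)%N) :
  (ergodic_on R n SL2Z /\ essentially_free R n) /\
  (~~ odd n -> forall h : 'M[int]_2, SL2Z h -> hyperbolic h ->
     ergodic_on R n (cyclic_subgroup h)).
Proof.
case: n hn => // n n0; split; first split.
- by apply: ergodic_dispersing => //; exact: dispersing_SL2Z.
- exact: essentially_free_rho.
move=> en h h1 hh A tA mA invA.
(* Invariance under the cyclic group includes invariance under the nonnegative powers, which already
   disperse. *)
apply: (@ergodic_dispersing R n [set h ^+ m | m in [set: nat]]) => //.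
- by move=> _ [m _ <-]; exact: SL2ZX.
- by apply: (dispersing_hyperbolic R) => //; move: en => /=; rewrite negbK.
- by move=> _ [m _ <-]; apply: invA; exists m%:Z.
Qed.
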